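(* Let $g\ge1$ be an integer, let $p$ be a prime with $\gcd(p,2(2g+1))=1$, and let $H=H_{\mathbf b}$ be a hyperelliptic curve over $\mathbb{F}_p$ given by a non-singular Weierstrass equation with $\mathbf b\in\mathbb{F}_p^{2g}$. Let $M$ be an integer with $1\le M<p$ and let $\mathfrak B=[R_0+1,R_0+M]\times\dots\times[R_{2g-1}+1,R_{2g-1}+M]$ with integers $R_j$ satisfying $0\le R_j<R_j+M<p$ for $j=0,\dots,2g-1$. Then for any odd integer $h\in[3,2g+1]$, $$N(H;\mathfrak B)<\left(M^{1/h}+M\left(\frac{M^4}{p}\right)^{2/(h(h+1))}\right)M^{o(1)}$$ as $M\to\infty$.
   Context: For $\mathbf a=(a_0,\dots,a_{2g-1})\in\mathbb{F}_p^{2g}$, $H_{\mathbf a}$ denotes the curve $Y^2=X^{2g+1}+a_{2g-1}X^{2g-1}+\dots+a_1X+a_0$ over $\mathbb{F}_p$ (non-singular means the discriminant of the right-hand polynomial is nonzero). Two such curves satisfy $H_{\mathbf a}\sim H_{\mathbf b}$ (are isomorphic) if and only if there exists $\alpha\in\mathbb{F}_p^*$ with $a_i\equiv\alpha^{4g+2-2i}b_i\pmod p$ for $i=0,\dots,2g-1$. Integer vectors in $\mathfrak B$ are viewed in $\mathbb{F}_p^{2g}$ by reduction modulo $p$. $N(H;\mathfrak B)=\#\{\mathbf a\in\mathfrak B\cap\mathbb{Z}^{2g}: H_{\mathbf a}\sim H\}$. $M^{o(1)}$ denotes a factor $M^{\varepsilon(M)}$ with $\varepsilon(M)\to0$ as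 $M\to\infty$, uniformly in $p,H,\mathfrak B$ (possibly depending on $g$). *)

(* Defs.v *)
From HB Require Import structures.
From mathcomp Require Import all_boot all_order all_algebra.
From mathcomp Require Import finmap.
From mathcomp Require Import all_classical all_reals all_analysis.

Set Implicit Arguments.
Unset Strict Implicit.
Unset Printing Implicit Defensive.

Import Order.TTheory GRing.Theory Num.Theory.

Local Open Scope classical_set_scope.
Local Open Scope ring_scope.

(* disc f = (-1)^(n(n-1)/2) lead_coef(f)^-1 Res(f, f') with n = deg f.
   [resultant] uses the actual degree of f'; this agrees with the formal degree
   n - 1 as long as n is nonzero in F. *)
Definition discriminant (F : fieldType) (f : {poly F}) : F :=
  (-1) ^+ 'C((size f).-1, 2) * (lead_coef f)^-1 * resultant f f^`().

Definition weierstrass (F : fieldType) (g : nat) (a : 'rV[F]_(2 * g)) : {poly F} :=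
  'X^(2 * g + 1) + \sum_(i < 2 * g) a 0 i *: 'X^i.

Definition nonsingular (F : fieldType) (g : nat) (a : 'rV[F]_(2 * g)) : Prop :=
  discriminant (weierstrass a) != 0.

(* H_a ~ H_b: isomorphism of Weierstrass equations. The subtraction in the
   exponent does not truncate, since i < 2g. *)
Definition curve_iso (F : fieldType) (g : nat) (a b : 'rV[F]_(2 * g)) : Prop :=
  exists2 alpha : F, alpha != 0 &
    forall i : 'I_(2 * g), a 0 i = alpha ^+ (4 * g + 2 - 2 * i) * b 0 i.

(* The integer points of the product of the intervals [r_j + 1, r_j + M]. *)
Definition int_box (n : nat) (r : 'rV[int]_n) (M : nat) : set 'rV[int]_n :=
  [set a | forall j : 'I_n, r 0 j + 1 <= a 0 j <= r 0 j + M%:Z].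

(* [fset_set] returns the empty finite set on infinite sets; the set counted
   here is finite, being contained in a box. *)
Definition iso_count (g p : nat) (b : 'rV['F_p]_(2 * g))
    (B : set 'rV[int]_(2 * g)) : nat :=
  #|` fset_set [set a | B a /\ curve_iso (map_mx intr a) b] |%fset.

(* Main.v *)
(* Since the entries of a vector in the box are nonzero modulo p, N = 0 unless all
   b_i are nonzero.  If a_i = alpha^(4g+2-2i) b_i, then t = alpha^2 determines a
   and the entries x = a_(2g-1) = beta t^2, y = a_(2g+1-h) = gamma t^h lie on a
   cuspidal curve y^2 = const * x^h over F_p; so it suffices to count the t for
   which (x, y) lies in a box of side M.

   If a short x-interval of length L contains more than 2h of these points, they
   determine a curve D v^2 + c v + P(u) = 0 with integer coefficients, where u, v
   are the coordinates of the points in the box.  A determinant that is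
   divisible by p and smaller than p shows that this curve contains all the
   points of an x-interval of length W = L M^(1/h), provided that
   L^(h(h+1)/2) M^4 is less than a small constant times p.  A q-adic version of the
   Bombieri-Pila determinant method then bounds the number of points in the
   longer interval by M^(1/h + o(1)); the same bound is immediate if every short
   interval contains at most 2h points.  Covering by M/W + 1 intervals gives
   (M/L + M^(1/h)) M^o(1), and the largest admissible L gives the theorem. *)

Require Import Defs.
From HB Require Import structures.
From mathcomp Require Import all_boot all_order all_algebra all_fingroup.
From mathcomp Require Import finmap.
From mathcomp Require Import all_classical all_reals all_analysis.
From mathcomp Require Import zify ring lra.

Set Implicit Arguments.
Unset Strict Implicit.
Unset Printing Implicit Defensive.

Import Order.TTheory GRing.Theory Num.Theory.
Import numFieldNormedType.Exports.

Local Open Scope ring_scope.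

(** * Determinants: nonzero minors, size bounds and divisibility by powers *)

(** Among the terms with nonzero weight, the one of largest size alone reaches its top
    coefficient. *)
Lemma comb_distinct_sizes_eq0 (F : fieldType) (n : nat)
    (phi : 'I_n -> {poly F}) (w : 'I_n -> F) :
  (forall i, phi i != 0) -> injective (fun i => size (phi i)) ->
  \sum_i w i *: phi i = 0 -> forall i, w i = 0.
Proof.
move=> phi0 phi_inj sum0 i; apply/eqP; apply/negPn/negP => wi.
case: (@arg_maxnP _ i (fun j => w j != 0) (fun j => size (phi j)) wi) => j wj max_j.
have /eqP := congr1 (fun q : {poly F} => q`_(size (phi j)).-1) sum0.
rewrite coef_sum coef0 (bigD1 j) //= big1 ?addr0 => [|k kj].
  by rewrite coefZ mulf_eq0 (negPf wj) /= -/(lead_coef (phi j)) lead_coef_eq0 (negPf (phi0 j)).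
rewrite coefZ; have [->|wk] := eqVneq (w k) 0; first by rewrite mul0r.
rewrite nth_default ?mulr0 //.
have := max_j k wk; rewrite /= leq_eqVlt => /orP[/eqP/phi_inj e|].
  by rewrite e eqxx in kj.
by move=> h; rewrite -ltnS (leq_trans h) // leqSpred.
Qed.

(** A dependence between the columns of the evaluation matrix over all of [T] would be a nonzero
    polynomial of degree at most d with more than d roots. So the matrix has full column rank. *)
Lemma exists_minor_neq0 (F : finFieldType) (n d : nat)
    (phi : 'I_n -> {poly F}) (T : {set F}) :
  (forall i, phi i != 0) -> injective (fun i => size (phi i)) ->
  (forall i, (size (phi i) <= d.+1)%N) -> (d < #|T|)%N ->
  exists2 f : 'I_n -> F, (forall i, f i \in T) &
    \det (\matrix_(i, j) (phi j).[f i]) != 0.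
Proof.
move=> phi0 phi_inj phi_d dT.
pose A := \matrix_(i < #|T|, j < n) (phi j).[enum_val i].
have A_full : row_full A.
  rewrite /row_full -mxrank_tr; apply: inj_row_free => v vA0.
  pose q := \sum_j v 0 j *: phi j.
  have q_root i : root q (enum_val (A := T) i).
    apply/rootP; rewrite horner_sum.
    transitivity ((v *m A^T) 0 i); last by rewrite vA0 mxE.
    by rewrite mxE; apply: eq_bigr => j _; rewrite hornerZ !mxE.
  have q0 : q = 0.
    apply/eqP; apply/negPn/negP => qn0.
    have := @max_poly_roots _ q (enum T) qn0.
    have -> : all (root q) (enum T).
      apply/allP => x; rewrite mem_enum => xT.
      by rewrite -(enum_rankK_in xT xT).
    rewrite enum_uniq -cardE => /(_ isT isT).
    rewrite ltnNge (leq_trans _ dT) //.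
    by apply: (leq_trans (size_sum _ _ _)); apply/bigmax_leqP => j _;
       apply: (leq_trans (size_scale_leq _ _)).
  apply/rowP => j; rewrite [RHS]mxE.
  exact: (comb_distinct_sizes_eq0 phi0 phi_inj q0).
exists (fun i => enum_val (fullrankfun A_full i)) => [i|]; first exact: enum_valP.
have := fullrowsub_unit A_full; rewrite unitmxE unitfE.
by congr (\det _ != 0); apply/matrixP => i j; rewrite !mxE.
Qed.

(** Each of the n! Leibniz terms meets every row and every column exactly once, so all of them have
    the same bound. *)
Lemma ler_norm_det (R : numDomainType) (n : nat) (A : 'M[R]_n) (c a : 'I_n -> R) :
  (forall i j, `|A i j| <= c i * a j) ->
  `|\det A| <= n`!%:R * (\prod_i c i) * \prod_j a j.
Proof.
move=> Aca; apply: le_trans (ler_norm_sum _ _ _) _.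
have -> : n`!%:R * (\prod_i c i) * (\prod_j a j) =
    \sum_(s : 'S_n) (\prod_i c i) * (\prod_j a j).
  by rewrite sumr_const card_Sn -mulrA mulr_natl.
apply: ler_sum => s _; rewrite normrM normrX normrN1 expr1n mul1r normr_prod.
rewrite [X in _ <= _ * X](reindex_inj (@perm_inj _ s)) /= -big_split /=.
by apply: ler_prod => i _; rewrite normr_ge0 Aca.
Qed.

(** By pigeonhole, n + 1 distinct naturals include one that is at least n; removing it gives the
    induction. *)
Lemma bin2_size_le_sumn (s : seq nat) : uniq s -> ('C(size s, 2) <= sumn s)%N.
Proof.
elim: {s}(size s) {-2}s (erefl (size s)) => [|n IHn] s ss us; first by rewrite ss.
have /hasP[x xs nx] : has (fun x => n <= x)%N s.
  apply/negPn/negP => /hasPn s_lt.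
  have : (size s <= size (iota 0 n))%N.
    by apply: uniq_leq_size => // x /s_lt; rewrite mem_iota -ltnNge.
  by rewrite size_iota ss ltnn.
have -> : sumn s = (x + sumn (rem x s))%N by rewrite (perm_sumn (perm_to_rem xs)).
have s' : size (rem x s) = n by rewrite size_rem // ss.
have := IHn _ s' (rem_uniq _ us); rewrite ss s' binS bin1 addnC => h.
exact: leq_add.
Qed.

Lemma bin2_le_sum_inj (n N : nat) (f : 'I_n -> 'I_N) :
  injective f -> ('C(n, 2) <= \sum_j f j)%N.
Proof.
move=> f_inj; have := @bin2_size_le_sumn [seq val (f j) | j <- enum 'I_n].
rewrite size_map size_enum_ord map_inj_uniq ?enum_uniq; last first.
  by move=> j k /val_inj /f_inj.
by move=> /(_ isT); rewrite sumnE big_map big_enum.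
Qed.

Lemma dvdz_prod (I : finType) (x y : I -> int) :
  (forall i, (x i %| y i)%Z) -> (\prod_i x i %| \prod_i y i)%Z.
Proof.
by move=> xy; elim/big_ind2: _ => // y1 z1 y2 z2; apply: dvdz_mul.
Qed.

(** Multilinear expansion picks one exponent per column. A repeated exponent gives two equal columns
    and no contribution; distinct exponents sum to at least 0 + 1 + ... + (n - 1). *)
Lemma dvdz_det_powers (n N : nat) (q : int) (x : 'I_n -> int) (c : 'I_n -> 'I_N -> int) :
  (forall i, (q %| x i)%Z) ->
  (q ^+ 'C(n, 2) %| \det (\matrix_(i, j) \sum_l c j l * x i ^+ l))%Z.
Proof.
move=> qx; rewrite -det_tr.
have -> : \det (\matrix_(i, j) \sum_l c j l * x i ^+ l)^T =
   \sum_(f : {ffun 'I_n -> 'I_N})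
     (\prod_j c j (f j)) * \det (\matrix_(j, i) x i ^+ f j).
  under [RHS]eq_bigr => f _ do rewrite big_distrr /=.
  rewrite exchange_big /=; apply: eq_bigr => s _.
  under eq_bigr => j _ do rewrite !mxE.
  rewrite bigA_distr_bigA big_distrr /=; apply: eq_bigr => f _.
  rewrite mulrCA; congr (_ * _); rewrite big_split /=; congr (_ * _).
  by apply: eq_bigr => j _; rewrite mxE.
elim/big_ind: _ => [|y z|f _]; [exact: dvdz0 | exact: rpredD |].
apply: dvdz_mull; have [/injectiveP f_inj|] := boolP (injectiveb f).
  have sum_f := bin2_le_sum_inj f_inj; rewrite /determinant.
  elim/big_ind: _ => [|y z|s _]; [exact: dvdz0 | exact: rpredD |].
  apply: dvdz_mull; apply: dvdz_trans (dvdz_exp2l _ sum_f) _.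
  rewrite expr_sum; apply: dvdz_prod => j; rewrite mxE.
  exact: dvdz_exp2r.
case/injectivePn => j [k jk fjk].
rewrite (determinant_alternate jk) ?dvdz0 // => i.
by rewrite !mxE fjk.
Qed.

(** Expanding each polynomial around u makes its entries combinations of powers of z - u, which q
    divides. *)
Lemma dvdz_det_horner (n : nat) (q u : int) (z : 'I_n -> int) (G : 'I_n -> {poly int}) :
  (forall i, (q %| z i - u)%Z) ->
  (q ^+ 'C(n, 2) %| \det (\matrix_(i, j) (G j).[z i]))%Z.
Proof.
move=> qz; pose H j := G j \Po ('X + u%:P).
pose N := (\max_j size (H j))%N.
have -> : \matrix_(i, j) (G j).[z i] =
    \matrix_(i, j) \sum_(l < N) (H j)`_l * (z i - u) ^+ l.
  apply/matrixP => i j; rewrite !mxE -horner_coef_wide; last exact: leq_bigmax.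
  by rewrite horner_comp hornerD hornerX hornerC subrK.
exact: dvdz_det_powers.
Qed.

Lemma dvdz_det_congr (n : nat) (m : int) (A B : 'M[int]_n) :
  (forall i j, (m %| A i j - B i j)%Z) -> (m %| \det A)%Z = (m %| \det B)%Z.
Proof.
move=> AB; have : (m %| \det A - \det B)%Z; last first.
  by move=> h; rewrite -[\det A](subrK (\det B)) rpredDl.
rewrite /determinant -sumrB.
elim/big_ind: _ => [|y z|s _]; [exact: dvdz0 | exact: rpredD |].
rewrite -mulrBr; apply: dvdz_mull.
elim/big_rec2: _ => [|i y z _ yz]; first by rewrite subrr dvdz0.
have -> : A i (s i) * z - B i (s i) * y = (A i (s i) - B i (s i)) * z + B i (s i) * (z - y) by ring.
by apply: rpredD; [exact: dvdz_mulr | exact: dvdz_mull].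
Qed.

(** * Counting by fibres and roots, and Newton iteration *)

Lemma leq_card_fibers (X Y : finType) (A : {set X}) (Z : {set Y}) (f : X -> Y) (d : nat) :
  (forall x, x \in A -> f x \in Z) ->
  (forall y, y \in Z -> (#|[set x in A | f x == y]%SET| <= d)%N) ->
  (#|A| <= #|Z| * d)%N.
Proof.
move=> fAZ fib; rewrite -sum1_card (partition_big f (mem Z)) //=.
rewrite -[X in (_ <= X)%N]sum_nat_const; apply: leq_sum => y yZ.
apply: leq_trans (fib y yZ); rewrite -sum1_card.
by rewrite [X in (_ <= X)%N](eq_bigl (fun x => (x \in A) && (f x == y))) // => x; rewrite inE.
Qed.

Lemma leq_card_roots (F : finFieldType) (q : {poly F}) (d : nat) (T : {set F}) :
  q != 0 -> (size q <= d.+1)%N -> (forall t, t \in T -> root q t) -> (#|T| <= d)%N.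
Proof.
move=> q0 qd Tq; have := @max_poly_roots _ q (enum T) q0.
have -> : all (root q) (enum T) by apply/allP => t; rewrite mem_enum => /Tq.
rewrite enum_uniq -cardE => /(_ isT isT) lt.
by rewrite -ltnS (leq_trans lt).
Qed.

(** Newton iteration with a fixed inverse e of the derivative at v0 gains one factor q per step. The
    polynomial V serves all points of the residue class at once: there v is a polynomial function of
    u modulo a high power of q. *)
Lemma newton_root (q D c e v0 : int) (P : {poly int}) (N : nat) :
  (q %| 1 - e * (2 * D * v0 + c))%Z ->
  exists V : {poly int}, forall u v : int, (q %| v - v0)%Z ->
    D * v ^+ 2 + c * v + P.[u] = 0 -> (q ^+ N.+1 %| V.[u] - v)%Z.
Proof.
move=> qe; elim: N => [|N [V HV]].
  exists v0%:P => u v qv _; rewrite hornerC expr1.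
  by rewrite -opprB rpredN.
exists (V - e *: (D *: V ^+ 2 + c *: V + P)) => u v qv curve.
have qNV := HV u v qv curve; have [w Vw] := dvdzP qNV.
have qV : (q %| V.[u] - v)%Z by apply: dvdz_trans qNV; exact: dvdz_exp.
have [x Vx] := dvdzP qV; have [y vy] := dvdzP qv; have [z ez] := dvdzP qe.
have -> : (V - e *: (D *: V ^+ 2 + c *: V + P)).[u] - v =
  (V.[u] - v) * (1 - e * (D * (V.[u] + v) + c)).
  have Pu : P.[u] = - (D * v ^+ 2 + c * v) by apply/eqP; rewrite -addr_eq0 addrC curve.
  by rewrite !(hornerD, hornerN, hornerZ, horner_exp) Pu; ring.
rewrite exprSr; apply: dvdz_mul => //.
have -> : 1 - e * (D * (V.[u] + v) + c) =
  (1 - e * (2 * D * v0 + c)) - e * D * ((V.[u] - v) + 2 * (v - v0)) by ring.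
rewrite ez Vx vy; apply/dvdzP; exists (z - e * D * (x + 2 * y)); ring.
Qed.

(** * Points of the cuspidal curve in one residue class modulo q *)

Lemma size_quad_power (F : fieldType) (beta rho : F) (k : nat) : beta != 0 ->
  size ((beta *: 'X^2 - rho%:P) ^+ k) = (2 * k).+1.
Proof.
move=> b0; have s3 : size (beta *: 'X^2 - rho%:P) = 3.
  rewrite size_addl size_scale // ?size_polyXn //.
  by rewrite size_opp (leq_ltn_trans (size_polyC_leq1 _)).
have q0 : beta *: 'X^2 - rho%:P != 0 by rewrite -size_poly_eq0 s3.
by rewrite -(prednK (n := size _)) ?size_exp ?s3 // lt0n size_poly_eq0 expf_neq0.
Qed.

Lemma size_monomial_power (F : fieldType) (gamma sigma : F) (h k : nat) :
  gamma != 0 -> (0 < h)%N -> size ((gamma *: 'X^h - sigma%:P) ^+ k) = (h * k).+1.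
Proof.
move=> g0 h0; have s3 : size (gamma *: 'X^h - sigma%:P) = h.+1.
  rewrite size_addl size_scale // ?size_polyXn //.
  by rewrite size_opp (leq_ltn_trans (size_polyC_leq1 _)).
have q0 : gamma *: 'X^h - sigma%:P != 0 by rewrite -size_poly_eq0 s3.
by rewrite -(prednK (n := size _)) ?size_exp ?s3 // lt0n size_poly_eq0 expf_neq0.
Qed.

(** 2i + hj is the degree in t of x^i y^j. Modulo the odd number h it determines i. *)
Lemma weight_inj (h i j i' j' : nat) : odd h -> (i < h)%N -> (i' < h)%N ->
  (2 * i + h * j = 2 * i' + h * j')%N -> i = i' /\ j = j'.
Proof.
move=> oh ih ih' e.
have co : coprime h 2 by rewrite coprimen2.
have ii' : i = i'.
  have : (2 * i == 2 * i' %[mod h])%N.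
    have := congr1 (modn^~ h) e.
    by rewrite /= ![(2 * _ + h * _)%N]addnC ![(h * _)%N]mulnC !modnMDl => ->.
  wlog le : i i' ih ih' {e} / (i' <= i)%N.
    move=> W; have [/W|/ltnW/W] := leqP i' i; first exact.
    by move=> W' /eqP h1; symmetry; apply: W' => //; apply/eqP.
  rewrite eqn_mod_dvd ?leq_mul2l // -mulnBr Gauss_dvdr //.
  have [->|ne] := eqVneq i i' => //.
  move=> /dvdn_leq; rewrite subn_gt0 ltn_neqAle eq_sym ne le => /(_ isT).
  by lia.
split=> //; move: e; rewrite ii' => /addnI /eqP; rewrite eqn_mul2l => /orP[/eqP h0|/eqP //].
by rewrite h0 in oh.
Qed.

(* The parametrisation of the cuspidal curve y^2 = const * x^h by
   x = beta t^2, y = gamma t^h, where x = rho + u and y = sigma + v. *)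
Definition cusp_param (F : finFieldType) (h : nat) (T : {set F}) (u v : F -> int)
    (beta gamma rho sigma : F) : Prop :=
  [/\ beta != 0, gamma != 0,
      forall t, t \in T -> beta * t ^+ 2 = rho + (u t)%:~R &
      forall t, t \in T -> gamma * t ^+ h = sigma + (v t)%:~R].

Lemma cusp_param_sub (F : finFieldType) (h : nat) (T T' : {set F}) (u v : F -> int)
    (beta gamma rho sigma : F) :
  (forall t, t \in T' -> t \in T) -> cusp_param h T u v beta gamma rho sigma ->
  cusp_param h T' u v beta gamma rho sigma.
Proof. by move=> TT' [b0 g0 Tx Ty]; split=> // t /TT'; [exact: Tx | exact: Ty]. Qed.

(* As h is odd, the monomials x^i y^j with i < h have
   pairwise distinct degrees in t, so that a nonzero combination of them has
   boundedly many zeros on the curve; this replaces Bezout's theorem. *)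
Lemma residue_class_bound (F : finFieldType) (T : {set F}) (u v : F -> int)
    (beta gamma rho sigma : F) (h A M : nat) (D c u0 v0 e : int) (P : {poly int}) (q : int) :
  odd h -> cusp_param h T u v beta gamma rho sigma ->
  (forall t, t \in T -> `|u t| <= M%:Z) ->
  (forall t, t \in T -> `|v t| <= M%:Z) ->
  (forall t, t \in T -> D * v t ^+ 2 + c * v t + P.[u t] = 0) ->
  (forall t, t \in T -> (q %| u t - u0)%Z) ->
  (forall t, t \in T -> (q %| v t - v0)%Z) ->
  (q %| 1 - e * (2 * D * v0 + c))%Z ->
  ((h * A)`! * M ^ (\sum_(k < h * A) (k %% h + k %/ h)))%:Z < q ^+ 'C(h * A, 2) ->
  (#|T| <= 2 * h + h * A)%N.
Proof.
move=> oh [b0 g0 Tx Ty] Tu Tv curve qu qv qe q_big; rewrite leqNgt; apply/negP => Tbig.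
have h0 : (0 < h)%N by rewrite odd_gt0.
pose n := (h * A)%N.
(* The index k encodes the monomial u^(k mod h) v^(k / h), written here as a polynomial in t. *)
pose phi (k : 'I_n) : {poly F} :=
  (beta *: 'X^2 - rho%:P) ^+ (k %% h) * (gamma *: 'X^h - sigma%:P) ^+ (k %/ h).
have size_phi k : size (phi k) = (2 * (k %% h) + h * (k %/ h)).+1.
  rewrite size_mul -?size_poly_eq0 ?size_quad_power ?size_monomial_power //.
  by rewrite addSn addnS.
have phi0 k : phi k != 0 by rewrite -size_poly_eq0 size_phi.
have phi_inj : injective (fun k => size (phi k)).
  move=> k l; rewrite !size_phi => -[/weight_inj []] //; rewrite ?ltn_mod // => e1 e2.
  by apply: val_inj; rewrite /= (divn_eq k h) (divn_eq l h) e1 e2.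
have phi_d k : (size (phi k) <= (2 * h + h * A).+1)%N.
  rewrite size_phi ltnS leq_add //.
    by rewrite leq_mul2l ltnW ?ltn_mod.
  by rewrite leq_mul2l ltnW ?orbT // ltn_divLR // mulnC.
have [f fT fdet] := exists_minor_neq0 phi0 phi_inj phi_d Tbig.
pose E : 'M[int]_n := \matrix_(i, k) (u (f i) ^+ (k %% h) * v (f i) ^+ (k %/ h)).
have E0 : \det E != 0.
  apply: contraNneq fdet => E0; have := congr1 (fun x : int => x%:~R : F) E0.
  rewrite -det_map_mx rmorph0 => <-; apply/eqP; congr (\det _); apply/matrixP => i k.
  rewrite !mxE rmorphM !rmorphXn /= hornerM !horner_exp !(hornerD, hornerN, hornerZ, hornerXn, hornerC).
  by rewrite Tx // Ty // ![_ + _%:~R]addrC !addrK.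
have E_small : `|\det E| <= ((h * A)`! * M ^ (\sum_(k < h * A) (k %% h + k %/ h)))%:Z.
  apply: le_trans (ler_norm_det (c := fun=> 1) (a := fun k => M%:Z ^+ (k %% h + k %/ h)) _) _.
    move=> i k; rewrite mxE mul1r normrM !normrX exprD.
    by apply: ler_pM; rewrite ?exprn_ge0 // lerXn2r ?nnegrE // ?Tu ?Tv.
  by rewrite big1 // mulr1 -expr_sum PoszM -!natz natrX.
have [V HV] := newton_root P 'C(n, 2) qe.
(* Replacing v by V(u) turns every column into a polynomial in u, and u is constant modulo q; so
   q^C(n,2) divides the nonzero determinant, which is smaller than that. *)
pose G (k : 'I_n) : {poly int} := 'X ^+ (k %% h) * V ^+ (k %/ h).
have qE : (q ^+ 'C(n, 2) %| \det E)%Z.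
  rewrite (@dvdz_det_congr _ _ _ (\matrix_(i, k) (G k).[u (f i)])).
    by apply: (@dvdz_det_horner _ _ u0) => i; exact: qu.
  move=> i k; rewrite !mxE hornerM !horner_exp hornerX -mulrBr; apply: dvdz_mull.
  rewrite subrXX; apply: dvdz_mulr; rewrite -opprB rpredN.
  apply: dvdz_trans (HV _ _ (qv _ (fT i)) (curve _ (fT i))).
  by apply: dvdz_exp2l.
have : q ^+ 'C(n, 2) <= `|\det E|.
  apply: le_trans (ler_norm _) _; rewrite -!abszE lez_nat dvdn_leq // absz_gt0 //.
by rewrite leNgt (le_lt_trans E_small q_big).
Qed.

(** * Supply of primes from central binomial coefficients *)

(** By Legendre's formula the exponent is the sum of floor(2n / q^k) - 2 floor(n / q^k). Each term
    is at most 1 and vanishes once q^k > 2n. *)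
Lemma expn_logn_central_bin_le (q n : nat) : prime q -> (0 < n)%N ->
  (q ^ logn q 'C(2 * n, n) <= 2 * n)%N.
Proof.
move=> pq n0; have q1 := prime_gt1 pq; have q0 := prime_gt0 pq.
have n2 : (n <= 2 * n)%N by rewrite leq_pmull.
have n20 : (0 < 2 * n)%N by rewrite muln_gt0.
suff le : (logn q 'C(2 * n, n) <= trunc_log q (2 * n))%N.
  exact: leq_trans (leq_pexp2l q0 le) (trunc_logP q1 n20).
have := congr1 (logn q) (bin_fact n2).
rewrite (_ : (2 * n - n = n)%N); last by lia.
rewrite !lognM ?muln_gt0 ?fact_gt0 ?bin_gt0 // !logn_fact //.
have wide : (\sum_(1 <= k < n.+1) n %/ q ^ k = \sum_(1 <= k < (2 * n).+1) n %/ q ^ k)%N.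
  rewrite [RHS](big_cat_nat (n := n.+1)) //= -[LHS]addn0; congr addn.
  rewrite big_nat_cond big1 // => k /andP[/andP[nk _] _]; apply: divn_small.
  by apply: ltn_trans nk _; apply: ltn_expl.
rewrite wide.
have : (\sum_(1 <= k < (2 * n).+1) (2 * n) %/ q ^ k <=
    (\sum_(1 <= k < (2 * n).+1) n %/ q ^ k + \sum_(1 <= k < (2 * n).+1) n %/ q ^ k)
    + \sum_(1 <= k < (2 * n).+1) (q ^ k <= 2 * n))%N.
  rewrite -!big_split /=; apply: leq_sum => k _.
  have qk0 : (0 < q ^ k)%N by rewrite expn_gt0 q0.
  have [qk|qk] := leqP (q ^ k) (2 * n); last by rewrite divn_small.
  rewrite -ltnS ltn_divLR //.
  have := divn_eq n (q ^ k); have := ltn_pmod n qk0; nia.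
have : (\sum_(1 <= k < (2 * n).+1) (q ^ k <= 2 * n) <= trunc_log q (2 * n))%N; last by lia.
rewrite -big_mkcond /= sum1_count.
have -> : trunc_log q (2 * n) = size (iota 1 (trunc_log q (2 * n))) by rewrite size_iota.
rewrite -size_filter; apply: uniq_leq_size; first by rewrite filter_uniq ?iota_uniq.
move=> k; rewrite mem_filter !mem_iota => /andP[qk /andP[k1 _]].
rewrite k1 add1n ltnS; exact: trunc_log_max.
Qed.

(** The coefficient is the product of the fractions (2n - i) / (n - i), each at least 2. *)
Lemma exp2_le_central_bin (n : nat) : (2 ^ n <= 'C(2 * n, n))%N.
Proof.
rewrite -(leq_pmul2r (fact_gt0 n)) bin_ffact ffact_prod -ffactnn ffact_prod.
have -> : (2 ^ n = \prod_(i < n) 2)%N by rewrite prod_nat_const card_ord.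
rewrite -big_split /=; apply: leq_prod => i _; lia.
Qed.

(** Chebyshev's argument: each prime power dividing C(2n, n) is at most 2n, so this coefficient has
    more than X + K prime divisors, and at most X of them are at most X. *)
Lemma exists_many_primes (X K n : nat) : (0 < n)%N -> ((2 * n) ^ (X + K) < 2 ^ n)%N ->
  exists qs : seq nat, [/\ uniq qs, size qs = K &
    forall q, q \in qs -> [/\ prime q, (X < q)%N & (q <= 2 * n)%N]].
Proof.
move=> n0 nXK.
pose m := 'C(2 * n, n); pose ps := primes m.
have m0 : (0 < m)%N by rewrite bin_gt0 leq_pmull.
have ps_size : (X + K < size ps)%N.
  rewrite ltnNge; apply/negP => le.
  have : (m <= (2 * n) ^ size ps)%N.
    rewrite [leqLHS](prod_prime_decomp m0) prime_decompE big_map /=.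
    have -> : ((2 * n) ^ size ps = \prod_(q <- ps) (2 * n))%N.
      by rewrite big_const_seq count_predT iter_muln_1.
    rewrite big_seq [leqRHS]big_seq; apply: leq_prod => q.
    by rewrite mem_primes => /andP[pq _]; exact: expn_logn_central_bin_le.
  rewrite leqNgt (leq_ltn_trans _ (leq_trans nXK (exp2_le_central_bin n))) //.
  by rewrite leq_pexp2l // muln_gt0.
pose rs := [seq q <- ps | (X < q)%N].
have rs_size : (K <= size rs)%N.
  have : (size [seq q <- ps | ~~ (X < q)%N] <= X)%N.
    rewrite -[leqRHS](size_iota 1 X); apply: uniq_leq_size.
      by rewrite filter_uniq ?primes_uniq.
    move=> q; rewrite mem_filter mem_iota add1n ltnS -leqNgt => /andP[-> qm].
    by rewrite andbT; move: qm; rewrite mem_primes => /andP[/prime_gt0].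
  have : (count (fun q => X < q)%N ps + count (fun q => ~~ (X < q))%N ps = size ps)%N.
    exact: count_predC.
  by rewrite !size_filter; move: ps_size; lia.
exists (take K rs); split; first by rewrite take_uniq // filter_uniq ?primes_uniq.
  by rewrite size_takel.
move=> q /mem_take; rewrite mem_filter mem_primes => /andP[Xq /and3P[pq _ qm]]; split=> //.
apply: leq_trans (expn_logn_central_bin_le pq n0).
by rewrite -[leqLHS]expn1 leq_pexp2l ?(prime_gt0 pq) // logn_gt0 mem_primes pq m0.
Qed.

Lemma prod_primes_dvdn (qs : seq nat) (m : nat) : uniq qs ->
  (forall q, q \in qs -> prime q /\ (q %| m)%N) -> (\prod_(q <- qs) q %| m)%N.
Proof.
elim: qs => [|q qs IHqs] /=; first by rewrite big_nil dvd1n.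
move=> /andP[q_qs uqs] Hqs; rewrite big_cons.
have [pq qm] := Hqs q (mem_head _ _).
rewrite Gauss_dvd ?qm ?IHqs // => [r rqs|]; first by apply: Hqs; rewrite inE rqs orbT.
rewrite big_seq; elim/big_ind: _ => [|x y|r rqs]; first exact: coprimen1.
  by rewrite coprimeMr => -> ->.
have [pr _] : prime r /\ (r %| m)%N by apply: Hqs; rewrite inE rqs orbT.
rewrite prime_coprime // dvdn_prime2 //.
by apply: contraNneq q_qs => ->.
Qed.

Lemma leq_prod_primes (qs : seq nat) (X : nat) :
  (forall q, q \in qs -> (X <= q)%N) -> (X ^ size qs <= \prod_(q <- qs) q)%N.
Proof.
move=> Xqs; have -> : (X ^ size qs = \prod_(q <- qs) X)%N.
  by rewrite big_const_seq count_predT iter_muln_1.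
by rewrite big_seq [leqRHS]big_seq; apply: leq_prod.
Qed.

(** If J primes above X divided m, so would their product, which exceeds m. *)
Lemma exists_primes_not_dvd (X J K n m : nat) : (0 < n)%N ->
  ((2 * n) ^ (X + (J + K)) < 2 ^ n)%N -> (0 < X)%N -> (0 < m)%N -> (m < X ^ J)%N ->
  exists qs : seq nat, [/\ uniq qs, size qs = K &
    forall q, q \in qs -> [/\ prime q, (X < q)%N, (q <= 2 * n)%N & ~~ (q %| m)%N]].
Proof.
move=> n0 /(exists_many_primes n0)[qs [uqs sqs Hqs]] X0 m0 mXJ.
pose rs := [seq q <- qs | ~~ (q %| m)%N].
have rs_size : (K <= size rs)%N.
  have : (size [seq q <- qs | (q %| m)%N] < J)%N.
    rewrite ltnNge; apply/negP => le; move: mXJ; rewrite ltnNge.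
    rewrite (leq_trans (leq_pexp2l X0 le)) // (leq_trans (leq_prod_primes _)) //.
      by move=> q; rewrite mem_filter => /andP[_ /Hqs[_ /ltnW]].
    apply: dvdn_leq => //; apply: prod_primes_dvdn; first exact: filter_uniq.
    by move=> q; rewrite mem_filter => /andP[-> /Hqs[]].
  have : (count (fun q => q %| m)%N qs + count (fun q => ~~ (q %| m))%N qs = size qs)%N.
    exact: count_predC.
  by rewrite !size_filter sqs; lia.
exists (take K rs); split; first by rewrite take_uniq // filter_uniq.
  by rewrite size_takel.
by move=> q /mem_take; rewrite mem_filter => /andP[qm /Hqs[]].
Qed.

(** * Points on an integral curve *)

(** Modulo q the curve is quadratic in v with nonzero leading coefficient, so the points fall into
    at most 2q residue classes, each handled by [residue_class_bound]. *)
Lemma nonsingular_points_bound (F : finFieldType) (T : {set F}) (u v : F -> int)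
    (beta gamma rho sigma : F) (h A M : nat) (D c : int) (P : {poly int}) (q : nat) :
  odd h -> cusp_param h T u v beta gamma rho sigma ->
  (forall t, t \in T -> `|u t| <= M%:Z) ->
  (forall t, t \in T -> `|v t| <= M%:Z) ->
  (forall t, t \in T -> D * v t ^+ 2 + c * v t + P.[u t] = 0) ->
  prime q -> ~~ (q%:Z %| D)%Z ->
  (forall t, t \in T -> ~~ (q%:Z %| 2 * D * v t + c)%Z) ->
  ((h * A)`! * M ^ (\sum_(k < h * A) (k %% h + k %/ h)) < q ^ 'C(h * A, 2))%N ->
  (#|T| <= 2 * q * (2 * h + h * A))%N.
Proof.
move=> oh cusp Tu Tv curve pq qD nonsing q_big.
have qF := dvdz_pcharf (pchar_Fp pq).
have card_q : #|'F_q| = q by rewrite card_Fp.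
pose cl t : 'F_q * 'F_q := ((u t)%:~R, (v t)%:~R).
pose R (a : 'F_q) : {poly 'F_q} :=
  D%:~R *: 'X^2 + (c%:~R *: 'X + ((map_poly intr P).[a])%:P).
pose Z : {set 'F_q * 'F_q} := [set z | root (R z.1) z.2]%SET.
have sizeR a : size (R a) = 3.
  rewrite size_addl size_scale ?size_polyXn -?qF //.
  apply: leq_ltn_trans (size_polyD _ _) _; rewrite gtn_max (leq_ltn_trans (size_scale_leq _ _)) ?size_polyX //.
  by rewrite (leq_ltn_trans (size_polyC_leq1 _)).
have cardZ : (#|Z| <= 2 * q)%N.
  rewrite mulnC -[in leqRHS]card_q -cardsT; apply: (leq_card_fibers (f := fst)) => [z|a _].
    by rewrite inE.
  apply: (@leq_trans #|[set b | root (R a) b]%SET|); last first.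
    by apply: (@leq_card_roots _ (R a)) => [||b]; rewrite -?size_poly_eq0 ?sizeR ?inE.
  apply: leq_trans (leq_imset_card (pair a) _); apply: subset_leq_card.
  apply/fintype.subsetP => -[a' b]; rewrite !inE /= => /andP[Rb /eqP <-].
  by apply: imset_f; rewrite inE.
apply: leq_trans (leq_mul cardZ (leqnn _)).
apply: (leq_card_fibers (f := cl)) => [t tT|z zZ].
  rewrite inE; apply/rootP; rewrite !(hornerD, hornerZ, hornerXn, hornerX, hornerC) /=.
  have := congr1 (fun x : int => x%:~R : 'F_q) (curve t tT).
  rewrite /= !rmorphD !rmorphM /= -horner_map /= rmorph0 => <-.
  by rewrite addrA.
have [->|[t0]] := set_0Vmem [set t in T | cl t == z]%SET; first by rewrite cards0.
rewrite inE => /andP[t0T /eqP clt0].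
(* An integer lift of the inverse of the v-derivative at a point of the class. *)
pose e : int := (val (((2 * D * v t0 + c)%:~R : 'F_q)^-1))%:Z.
apply: (@residue_class_bound _ _ u v beta gamma rho sigma h A M D c (u t0) (v t0) e P q%:Z) => //.
- by apply: cusp_param_sub cusp => t; rewrite inE => /andP[].
- by move=> t; rewrite inE => /andP[tT _]; exact: Tu.
- by move=> t; rewrite inE => /andP[tT _]; exact: Tv.
- by move=> t; rewrite inE => /andP[tT _]; exact: curve.
- move=> t; rewrite inE -clt0 => /andP[_ /eqP[e1 _]].
  by rewrite qF rmorphB /= e1 subrr.
- move=> t; rewrite inE -clt0 => /andP[_ /eqP[_ e1]].
  by rewrite qF rmorphB /= e1 subrr.
- rewrite qF rmorphB rmorph1 rmorphM /= /e -[_%:~R in X in X * _]/(_%:R) natr_Zp mulVf ?subrr //.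
  by rewrite -qF nonsing.
- by rewrite -!natz -natrX ltr_nat.
Qed.

Lemma leq_card_except (X : finType) (I : eqType) (A : {set X}) (S : I -> pred X)
    (B : nat) (qs : seq I) :
  (forall q, q \in qs -> (#|[set x in A | ~~ S q x]%SET| <= B)%N) ->
  (#|A| <= #|[set x in A | all (S^~ x) qs]%SET| + size qs * B)%N.
Proof.
elim: qs => [_|q qs IHqs Hqs] /=.
  by rewrite addn0 (_ : [set x in A | true]%SET = A) //; apply/setP => x; rewrite inE andbT.
apply: leq_trans (IHqs _) _ => [r rqs|]; first by apply: Hqs; rewrite inE rqs orbT.
rewrite mulSn addnA leq_add2r (leq_trans _ (leq_add (leqnn _) (Hqs q (mem_head _ _)))) //.
apply: leq_trans (leq_card_setU _ _); apply: subset_leq_card; apply/fintype.subsetP => x.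
by rewrite !inE => /andP[-> ->]; rewrite andbT; case: (S q x).
Qed.

(* A q-adic form of the Bombieri-Pila bound.  A point where D v^2 + c v + P(u)
   is singular modulo all of the primes qs has v determined modulo their product. *)
Lemma curve_points_bound (F : finFieldType) (T : {set F}) (u v : F -> int)
    (beta gamma rho sigma : F) (h A M Q : nat) (D c : int) (P : {poly int}) (qs : seq nat) :
  odd h -> cusp_param h T u v beta gamma rho sigma ->
  (forall t, t \in T -> `|u t| <= M%:Z) ->
  (forall t, t \in T -> 0 <= v t < M%:Z) ->
  (forall t, t \in T -> D * v t ^+ 2 + c * v t + P.[u t] = 0) ->
  uniq qs -> (M <= \prod_(q <- qs) q)%N ->
  (forall q, q \in qs -> [/\ prime q, ~~ (q%:Z %| 2 * D)%Z, (q <= Q)%N &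
     ((h * A)`! * M ^ (\sum_(k < h * A) (k %% h + k %/ h)) < q ^ 'C(h * A, 2))%N]) ->
  (#|T| <= h + size qs * (2 * Q * (2 * h + h * A)))%N.
Proof.
move=> oh cusp Tu Tv curve uqs Mqs Hqs.
have h0 : (0 < h)%N by rewrite odd_gt0.
have Tv' t : t \in T -> `|v t| <= M%:Z by move=> /Tv; lia.
apply: leq_trans (leq_card_except (S := fun q t => (q%:Z %| 2 * D * v t + c)%Z)
  (B := 2 * Q * (2 * h + h * A)) (qs := qs) _) _.
  move=> q /Hqs[pq qD qQ q_big].
  apply: leq_trans (nonsingular_points_bound (u := u) (v := v) (D := D) (c := c) (P := P)
    (M := M) (A := A) (h := h) (q := q) oh _ _ _ _ pq _ _ q_big) _.
  - by apply: cusp_param_sub cusp => t; rewrite inE => /andP[].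
  - by move=> t; rewrite inE => /andP[tT _]; exact: Tu.
  - by move=> t; rewrite inE => /andP[tT _]; exact: Tv'.
  - by move=> t; rewrite inE => /andP[tT _]; exact: curve.
  - by apply: contra qD; exact: dvdz_mull.
  - by move=> t; rewrite inE => /andP[].
  - by rewrite leq_mul2r leq_mul2l qQ !orbT.
rewrite leq_add2r; set S := [set t in T | _]%SET.
have [->|[t0]] := set_0Vmem S; first by rewrite cards0.
rewrite inE => /andP[t0T sing0].
have v_const t : t \in S -> v t = v t0.
  rewrite inE => /andP[tT sing].
  have : (\prod_(q <- qs) q %| `|v t - v t0|)%N.
    apply: prod_primes_dvdn => // q qqs; have [pq qD _ _] := Hqs q qqs; split=> //.
    have : (q%:Z %| 2 * D * (v t - v t0))%Z.
      have -> : 2 * D * (v t - v t0) = (2 * D * v t + c) - (2 * D * v t0 + c) by ring.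
      by apply: rpredB; [exact: (allP sing) | exact: (allP sing0)].
    by rewrite Gauss_dvdzr // coprimezE prime_coprime.
  have [->|ne] := eqVneq (v t) (v t0) => //.
  move=> /dvdn_leq; rewrite absz_gt0 subr_eq0 ne => /(_ isT).
  have := Tv t tT; have := Tv t0 t0T; lia.
have [b0 g0 _ Ty] := cusp.
(* With v fixed, t is a root of a polynomial of degree h, whence the summand h. *)
have := size_monomial_power (sigma + (v t0)%:~R) 1 g0 h0.
rewrite expr1 muln1 => sz; apply: (@leq_card_roots _ _ h) (eq_leq sz) _.
  by rewrite -size_poly_eq0 sz.
move=> t tS; rewrite /root !(hornerD, hornerN, hornerZ, hornerXn, hornerC).
by rewrite Ty ?v_const ?subrr //; move: tS; rewrite inE => /andP[].
Qed.

(** * From many points in a short interval to an integral curve *)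

(** The first h + 3 of these span every shifted equation of a curve y^2 = const * x^h. With y^2 at
    index 0, its coefficient is the cofactor built from all the other monomials. *)
Definition curve_monomial (k : nat) (R : nzRingType) (x y : R) : R :=
  match k with 0%N => y ^+ 2 | 1%N => y | j.+2 => x ^+ j end.

Lemma rmorph_curve_monomial (k : nat) (R S : nzRingType) (f : {rmorphism R -> S}) (x y : R) :
  f (curve_monomial k x y) = curve_monomial k (f x) (f y).
Proof. by case: k => [|[|j]]; rewrite /= ?rmorphXn. Qed.

Lemma prod_curve_monomial (h : nat) (x y : int) :
  \prod_(k < h.+3) curve_monomial k x y = y ^+ 3 * x ^+ 'C(h.+1, 2).
Proof.
rewrite 2!big_ord_recl /= -expr_sum mulrA -exprSr.
by rewrite -bin2_sum big_mkord.
Qed.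

(* Modulo p the monomials v^2, v, 1, u, ..., u^h are dependent on the cuspidal
   curve. *)
Lemma det_curve_monomial_eq0 (F : finFieldType) (T : {set F}) (u v : F -> int)
    (beta gamma rho sigma : F) (h : nat) (s : 'I_h.+3 -> F) :
  cusp_param h T u v beta gamma rho sigma -> (forall i, s i \in T) ->
  (\det (\matrix_(i < h.+3, k < h.+3) curve_monomial k (u (s i)) (v (s i))))%:~R = 0 :> F.
Proof.
move=> [b0 g0 Tx Ty] sT; rewrite -det_map_mx -det_tr; apply/eqP/det0P.
pose q : {poly F} := ('X + rho%:P) ^+ h.
have size_q : size q = h.+1 by rewrite /q -[rho]opprK polyCN size_exp_XsubC.
(* The coefficients of beta^h (sigma + v)^2 - gamma^2 (rho + u)^h, which vanishes on the curve. *)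
pose w (k : nat) : F := match k with
  | 0%N => beta ^+ h
  | 1%N => 2 * sigma * beta ^+ h
  | j.+2 => - gamma ^+ 2 * q`_j + (beta ^+ h * sigma ^+ 2) *+ (j == 0%N) end.
exists (\row_(k < h.+3) w k).
  by apply/eqP => /rowP/(_ ord0)/eqP; rewrite !mxE /= expf_eq0 (negPf b0) andbF.
apply/rowP => i; rewrite !mxE; under eq_bigr => k _ do
  rewrite !mxE rmorph_curve_monomial /=.
set x := (u (s i))%:~R; set y := (v (s i))%:~R.
rewrite 2!big_ord_recl /=.
have -> : \sum_(j < h.+1) (- gamma ^+ 2 * q`_(bump 0 (bump 0 j)).-2 +
     (beta ^+ h * sigma ^+ 2) *+ ((bump 0 (bump 0 j)).-2 == 0%N)) * x ^+ (bump 0 (bump 0 j)).-2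
   = - gamma ^+ 2 * q.[x] + beta ^+ h * sigma ^+ 2.
  rewrite (horner_coef_wide (n := h.+1)) ?size_q //.
  under eq_bigr => j _ do rewrite mulrDl -mulrA.
  rewrite big_split /= -mulr_sumr; congr (_ + _).
  by rewrite big_ord_recl /= expr0 mulr1 big1 ?addr0 // => j _; rewrite mul0r.
rewrite horner_exp hornerD hornerX hornerC.
rewrite [x + _]addrC -Tx // exprMn.
have -> : beta ^+ h * y ^+ 2 + (2 * sigma * beta ^+ h * y +
   (- gamma ^+ 2 * (beta ^+ h * (s i ^+ 2) ^+ h) + beta ^+ h * sigma ^+ 2)) =
   beta ^+ h * ((sigma + y) ^+ 2 - (gamma * s i ^+ h) ^+ 2).
  by rewrite [(s i ^+ 2) ^+ h]exprAC; ring.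
by rewrite Ty // subrr mulr0.
Qed.

(* If an interval of length L contains many points, they determine a curve over
   the integers, which must then contain all points of an interval that is Y
   times longer, since the relevant determinants are divisible by p. *)
Lemma integer_curve (p : nat) (S T : {set 'F_p}) (u v : 'F_p -> int)
    (beta gamma rho sigma : 'F_p) (h M L Y : nat) :
  prime p -> odd h -> cusp_param h T u v beta gamma rho sigma ->
  (forall t, t \in S -> t \in T) -> (2 * h < #|S|)%N -> (0 < Y)%N ->
  (forall t, t \in S -> `|u t| <= L%:Z) ->
  (forall t, t \in T -> `|u t| <= (L * Y)%:Z) ->
  (forall t, t \in T -> `|v t| <= M%:Z) ->
  (h.+3`! * (Y ^ h * (M ^ 3 * L ^ 'C(h.+1, 2))) < p)%N ->
  exists D c : int, exists P : {poly int},
    [/\ D != 0, (`|D| <= h.+2`! * (M * L ^ 'C(h.+1, 2)))%N &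
        forall t, t \in T -> D * v t ^+ 2 + c * v t + P.[u t] = 0].
Proof.
move=> pp oh cusp ST Sbig Y0 Su Tu Tv p_big.
have [b0 g0 Tx Ty] := cusp; have pF := dvdz_pcharf (pchar_Fp pp).
have h0 : (0 < h)%N by rewrite odd_gt0.
(* The monomials v, 1, u, ..., u^h as polynomials in t: v has odd degree h and u^j has even degree
   2j, so the degrees are distinct and at most 2h. More than 2h points thus give a nonzero minor. *)
pose phi (k : 'I_h.+2) : {poly 'F_p} :=
  if val k is j.+1 then (beta *: 'X^2 - rho%:P) ^+ j else (gamma *: 'X^h - sigma%:P) ^+ 1.
have size_phi k : size (phi k) = if val k is j.+1 then (2 * j).+1 else h.+1.
  by rewrite /phi; case: (val k) => [|j]; rewrite ?size_quad_power ?size_monomial_power ?muln1.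
have phi0 k : phi k != 0 by rewrite -size_poly_eq0 size_phi; case: (val k).
have phi_inj : injective (fun k => size (phi k)).
  move=> k l; rewrite !size_phi => e; apply: val_inj.
  case: (val k) (val l) e => [|i] [|j] //; lia.
have phi_d k : (size (phi k) <= (2 * h).+1)%N.
  by rewrite size_phi; case: k => -[|j] /= kh; lia.
have [f fS fdet] := exists_minor_neq0 phi0 phi_inj phi_d Sbig.
pose B (k : 'I_h.+3) : 'M[int]_h.+2 :=
  \matrix_(i, j) curve_monomial (lift k j) (u (f i)) (v (f i)).
(* The curve is the determinant whose row 0 holds a variable point and whose other rows hold the
   points [f i]; these are its coefficients. *)
pose cof (k : 'I_h.+3) : int := (-1) ^+ k * \det (B k).
have cof0 : cof 0 = \det (B 0) by rewrite /cof expr0 mul1r.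
pose P := \sum_(j < h.+1) cof (lift ord0 (lift ord0 j)) *: 'X^j.
exists (cof 0), (cof (lift ord0 ord0)), P; split.
- rewrite cof0; apply: contraNneq fdet => B0.
  have := congr1 (fun x : int => x%:~R : 'F_p) B0.
  rewrite /= rmorph0 -det_map_mx => <-; apply/eqP; congr (\det _); apply/matrixP => i k.
  rewrite !mxE rmorph_curve_monomial /= /phi.
  case: k => -[|j] /= _; rewrite horner_exp !(hornerD, hornerN, hornerZ, hornerXn, hornerC).
    by rewrite expr1 Ty ?ST // addrC addKr.
  by rewrite Tx ?ST // [rho + _]addrC addrK.
- rewrite cof0 -lez_nat abszE.
  have /= := @ler_norm_det _ _ (B 0) (fun=> 1) (fun j => curve_monomial (lift ord0 j) L%:Z M%:Z) _.
  rewrite big1 // mulr1 big_ord_recl /= -expr_sum => W.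
  apply: le_trans (W _) _ => [i j|].
    rewrite mxE mul1r /=; case: j => -[|j] /= _; first by rewrite Tv // ST.
    by rewrite normrX lerXn2r ?nnegrE // Su.
  by rewrite -bin2_sum big_mkord -[leRHS]natz natrM [(M * _)%:R]natrM natrX !natz.
move=> t tT.
pose s (i : 'I_h.+3) : 'F_p := if unlift ord0 i is Some i' then f i' else t.
have sT i : s i \in T by rewrite /s; case: unlift => // i'; apply: ST.
pose E : 'M[int]_h.+3 := \matrix_(i, k) curve_monomial k (u (s i)) (v (s i)).
have E0 : \det E = 0.
  have pE : (p %| `|\det E|)%N.
    by have := det_curve_monomial_eq0 cusp sT => /eqP; rewrite -pF.
  apply/eqP; rewrite -absz_eq0; apply/negPn/negP => Ene.
  have := dvdn_leq _ pE; rewrite lt0n Ene leqNgt => /(_ isT)/negP; apply.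
  apply: leq_ltn_trans p_big; rewrite -lez_nat abszE.
  (* Only the row of [t] may leave the short interval; the factor Y^h pays for its powers of u up to
     u^h. *)
  have /= := @ler_norm_det _ _ E (fun i => if i == ord0 then (Y ^ h)%:Z else 1)
    (fun k => curve_monomial k L%:Z M%:Z) _.
  rewrite prod_curve_monomial big_ord_recl eqxx big1 // mulr1 => W.
  apply: le_trans (W _) _ => [i k|]; last first.
    by rewrite -[leRHS]natz natrM [(Y ^ h * _)%:R]natrM [(M ^ 3 * _)%:R]natrM !natrX mulrA -natrX !natz.
  rewrite mxE; case: eqP => [->|/eqP i0].
    rewrite /s unlift_none -natz natrX.
    have Y1 : 1 <= Y%:R ^+ h :> int by rewrite exprn_ege1 // ler1n.
    case: k => -[|[|j]] /= kh.
    - apply: le_trans (ler_peMl _ Y1); last by rewrite exprn_ge0.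
      by rewrite normrX lerXn2r ?nnegrE // Tv.
    - by apply: le_trans (ler_peMl _ Y1) => //; exact: Tv.
    - have jh : (j <= h)%N by lia.
      rewrite normrX (@le_trans _ _ ((L * Y)%:Z ^+ j)) ?lerXn2r ?nnegrE ?Tu //.
      by rewrite PoszM exprMn mulrC ler_wpM2r ?exprn_ge0 // natz ler_weXn2l //.
  rewrite mul1r; rewrite eq_sym in i0; have [i' _ e] := unlift_some i0.
  rewrite /s e; case: k => -[|[|j]] /= _.
  - by rewrite normrX lerXn2r ?nnegrE // Tv // ST.
  - by rewrite Tv // ST.
  - by rewrite normrX lerXn2r ?nnegrE // Su.
rewrite -E0 (expand_det_row E ord0).
have cofE k : cofactor E ord0 k = cof k.
  rewrite /cofactor /cof add0n; congr (_ * \det _).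
  by apply/matrixP => i j; rewrite !mxE /s liftK.
under [RHS]eq_bigr => k _ do rewrite cofE mxE /s unlift_none.
rewrite 2!big_ord_recl /= addrA [cof 0 * _]mulrC [cof _ * v t]mulrC; congr (_ + _).
rewrite /P horner_sum; apply: eq_bigr => j _.
by rewrite hornerZ hornerXn mulrC.
Qed.

(** * Counting in blocks of short intervals, and the choice of parameters *)

(** With n = m + 1, Z^n < n^n (floor(Z / n) + 1)^n <= n^n 2^Z, and c n^n is at most one further
    factor Z. *)
Lemma poly_lt_exp2 (c m Z : nat) : (c * m.+1 ^ m.+1 <= Z)%N -> (c * Z ^ m < 2 ^ Z)%N.
Proof.
move=> cZ; pose n := m.+1; have n0 : (0 < n ^ n)%N by rewrite expn_gt0.
rewrite -(ltn_pmul2l n0).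
have ZE : (Z < n * (Z %/ n).+1)%N by rewrite mulnC ltn_ceil.
apply: (@leq_trans ((n * (Z %/ n).+1) ^ n)%N).
  apply: (@leq_ltn_trans (Z ^ n)); last by rewrite ltn_exp2r.
  by rewrite mulnA (mulnC (n ^ n)%N) (expnS Z m) leq_mul2r cZ orbT.
rewrite expnMn leq_mul2l (@leq_trans ((2 ^ (Z %/ n)) ^ n)) ?orbT //.
  by rewrite leq_exp2r // ltn_expl.
by rewrite -expnM leq_pexp2l // leq_trunc_div.
Qed.

Lemma mul2_bin2 (n : nat) : (2 * 'C(n, 2) = n * n.-1)%N.
Proof. by elim: n => // n; rewrite binS bin1; nia. Qed.

(** A block consists of Y consecutive intervals of length L. Either each holds at most 2h points, or
    a dense one yields an integral curve through all points of the block; the two summands bound the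
    two cases. *)
Lemma block_count (p : nat) (T : {set 'F_p}) (u v : 'F_p -> nat)
    (beta gamma rho sigma : 'F_p) (h A J M L N X Y a : nat) :
  prime p -> odd h ->
  cusp_param h T (Posz \o u) (Posz \o v) beta gamma rho sigma ->
  (forall t, t \in T -> (u t < M)%N) -> (forall t, t \in T -> (v t < M)%N) ->
  (0 < L <= M)%N -> (0 < Y)%N -> (0 < X)%N -> (0 < N)%N ->
  (h.+3`! * (Y ^ h * (M ^ 3 * L ^ 'C(h.+1, 2))) < p)%N ->
  (2 * (h.+2`! * M ^ ('C(h.+1, 2)).+1) < X ^ J)%N ->
  ((2 * N) ^ (X + (J + h)) < 2 ^ N)%N -> (M <= X ^ h)%N ->
  ((h * A)`! * M ^ (\sum_(k < h * A) (k %% h + k %/ h)) < X ^ 'C(h * A, 2))%N ->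
  (#|[set t in T | u t %/ L %/ Y == a]%SET| <=
     Y * (2 * h) + (h + h * (2 * (2 * N) * (2 * h + h * A))))%N.
Proof.
move=> pp oh cusp Tu Tv /andP[L0 LM] Y0 X0 N0 p_big XJ XN XM X_big.
set B := [set t in T | _]%SET.
pose f t : 'I_Y := Ordinal (ltn_pmod (u t %/ L) Y0).
have BT t : t \in B -> t \in T by rewrite inE => /andP[].
have [/forallP short|] := boolP [forall r, (#|[set t in B | f t == r]%SET| <= 2 * h)%N].
  apply: leq_trans (leq_addr _ _); rewrite -[Y in leqRHS](card_ord Y) -cardsT.
  by apply: (leq_card_fibers (f := f)).
rewrite negb_forall => /existsP[r]; rewrite -ltnNge; set S := [set t in B | _]%SET => Sbig.
pose b := (a * Y + r)%N.
have Sb t : t \in S -> (b * L <= u t < b * L + L)%N.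
  rewrite !inE => /andP[/andP[_ /eqP ta] /eqP tr].
  have -> : b = (u t %/ L)%N by rewrite /b [RHS](divn_eq _ Y) ta -tr.
  by rewrite leq_trunc_div -mulSnr ltn_ceil.
have SB t : t \in S -> t \in B by rewrite inE => /andP[].
have Bb t : t \in B -> (a * Y * L <= u t < a * Y * L + Y * L)%N.
  rewrite inE => /andP[_ /eqP <-].
  rewrite (leq_trans _ (leq_trunc_div (u t) L)) ?leq_mul2r ?leq_trunc_div ?orbT //=.
  by rewrite -mulnDl -mulSnr -!ltn_divLR.
have bM : (b * L < M)%N.
  have [t tS] : exists t, t \in S by apply/card_gt0P; apply: leq_ltn_trans Sbig.
  by have := Sb t tS; have := Tu t (BT t (SB t tS)); lia.
(* With the origin at the left end of the dense interval, |u'| is at most L on [S] and at most L * Y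
   on the block. *)
pose u' t : int := Posz (u t) - Posz (b * L).
have rb : (r * L <= Y * L)%N by rewrite leq_mul2r ltnW ?orbT.
have cusp' : cusp_param h B u' (Posz \o v) beta gamma (rho + (b * L)%:R) sigma.
  have [b0 g0 Tx Ty] := cusp; split=> // t /BT tT; last exact: Ty.
  by rewrite Tx // /u' rmorphB /= -!pmulrn -addrA; congr (_ + _); rewrite addrC subrK.
have Bv t : t \in B -> 0 <= (Posz \o v) t < M%:Z by move=> /BT/Tv /=; lia.
have BM t : t \in B -> `|u' t| <= M%:Z by move=> /BT/Tu; rewrite /u'; lia.
have [||t /Bv|D [c [P [D0 Dle curve]]]] := integer_curve pp oh cusp' SB Sbig Y0 _ _ _ p_big.
- by move=> t /Sb; rewrite /u'; lia.
- by move=> t /Bb; rewrite /u' /b; lia.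
- by lia.
have D20 : (0 < `|(2 * D)%R|)%N by rewrite absz_gt0 mulf_neq0.
have D2X : (`|(2 * D)%R| < X ^ J)%N.
  rewrite abszM; apply: leq_ltn_trans XJ; rewrite leq_mul2l /=.
  apply: leq_trans Dle _; rewrite leq_mul // expnS leq_mul // leq_exp2r //.
  by rewrite bin_gt0 ltnS odd_gt0.
(* Taking h primes above X makes their product at least X^h >= M, as [curve_points_bound]
   requires. *)
have [qs [uqs sqs Hqs]] := exists_primes_not_dvd N0 XN X0 D20 D2X.
apply: leq_trans (leq_addl _ _); rewrite -[X in (_ + X * _)%N]sqs.
apply: (curve_points_bound oh cusp' BM Bv curve uqs).
  apply: leq_trans XM _; rewrite -sqs; apply: leq_prod_primes => q /Hqs[_ /ltnW] //.
move=> q /Hqs[pq Xq qN qD]; split=> //.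
apply: leq_trans X_big _; case: ('C(h * A, 2)) => [|m]; first by rewrite !expn0.
by rewrite leq_exp2r // ltnW.
Qed.

(** The sum is the total degree of the monomials x^i y^j with i < h and j < A, the exponent of M in
    the determinant bound. *)
Lemma sum_mod_div (h A : nat) :
  (0 < h)%N -> (0 < A)%N ->
  (2 * \sum_(k < h * A) (k %% h + k %/ h) = h * A * (h + A - 2))%N.
Proof.
move=> h0; elim: A => // A IHA _.
have -> : (\sum_(k < h * A.+1) (k %% h + k %/ h) =
   \sum_(k < h * A) (k %% h + k %/ h) + \sum_(k < h) (k + A))%N.
  rewrite mulnSr -!(big_mkord xpredT (fun k => k %% h + k %/ h)%N).
  rewrite (big_cat_nat (n := (h * A)%N)) ?leq_addr //=; congr addn.
  rewrite -{1}[(h * A)%N]add0n [(h * A + h)%N]addnC big_addn addnK big_mkord.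
  apply: eq_bigr => k _; rewrite ![(k + _)%N]addnC [(h * A)%N]mulnC modnMDl divnMDl // modn_small // divn_small //; lia.
have sumk : (2 * \sum_(k < h) k = h * h.-1)%N.
  by rewrite -(big_mkord xpredT id) bin2_sum mul2_bin2.
have -> : (\sum_(k < h) (k + A) = \sum_(k < h) k + h * A)%N.
  by rewrite big_split /= sum_nat_const card_ord.
rewrite 2!mulnDr sumk.
case: A IHA => [_|A /(_ isT) ->]; first by rewrite muln0 big_ord0; nia.
nia.
Qed.

Lemma fact_le_expn (n : nat) : (n`! <= n ^ n)%N.
Proof.
elim: n => // n IHn; rewrite factS expnS leq_mul2l /=.
case: n IHn => // n IHn; apply: leq_trans IHn _; by rewrite leq_exp2r.
Qed.

Lemma bombieri_pila_exponent (h k M Y Z : nat) :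
  (0 < h)%N -> (0 < M)%N -> (M <= Y ^ h)%N -> (M <= Z ^ k)%N -> ((h * k.+1) ^ 2 < M)%N ->
  ((h * k.+1)`! * M ^ (\sum_(l < h * k.+1) (l %% h + l %/ h)) <
     (Y * Z) ^ 'C(h * k.+1, 2))%N.
Proof.
move=> h0 M0 MY MZ M_big; set n := (h * k.+1)%N; set s := (\sum_(l < n) _)%N.
have n0 : (0 < n)%N by rewrite muln_gt0 h0.
have sE : (2 * s = n * (h + k.+1 - 2))%N by exact: sum_mod_div.
have base : (n ^ 2 * M ^ (h + k.+1 - 2) < (Y * Z) ^ n.-1)%N.
  apply: (@leq_trans (M * M ^ (h + k.+1 - 2))%N).
    by rewrite ltn_pmul2r // expn_gt0 M0.
  have YZ0 : (0 < Y * Z)%N.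
    rewrite muln_gt0 !lt0n; apply/andP; split; apply/eqP => z0; subst.
      by move: (leq_trans M0 MY); rewrite exp0n.
    have M1 : (1 < M)%N by apply: leq_ltn_trans M_big; rewrite expn_gt0 muln_gt0 h0.
    by move: (leq_trans M1 MZ); case: (k) => // k'; rewrite exp0n.
  have -> : n.-1 = (h * k + h.-1)%N by rewrite /n; lia.
  rewrite expnD -expnS.
  have -> : ((h + k.+1 - 2).+1 = k + h)%N by lia.
  apply: leq_trans (leq_pmulr _ _); last by rewrite expn_gt0 YZ0.
  rewrite expnMn expnD leq_mul //.
    by rewrite expnM; case: (k) => // k'; rewrite leq_exp2r.
  by rewrite mulnC expnM leq_exp2r.
rewrite -(ltn_exp2r _ _ (e := 2)) // expnMn -!expnM [(s * 2)%N]mulnC sE.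
rewrite [('C(n, 2) * 2)%N]mulnC mul2_bin2 [(n * n.-1)%N]mulnC.
rewrite [X in (_ < X)%N]expnM; apply: leq_ltn_trans (_ : (n ^ 2 * M ^ (h + k.+1 - 2)) ^ n < _)%N; last first.
  by rewrite ltn_exp2r.
rewrite expnMn -!expnM [(n * (h + _ - _))%N]mulnC leq_mul //.
by rewrite [(2 * n)%N]mulnC [X in (_ <= X)%N]expnM leq_exp2r // fact_le_expn.
Qed.

(** Z is the spare small power of M. There are at most M / (LY) + 1 blocks, each with at most C * Y
    * Z^2 points; multiplying by L keeps the bound in the integers. *)
Lemma cusp_count (h k : nat) : odd h -> (0 < k)%N ->
  exists C M0 : nat, forall (p : nat) (T : {set 'F_p}) (u v : 'F_p -> nat)
    (beta gamma rho sigma : 'F_p) (M L Y Z : nat),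
  prime p -> cusp_param h T (Posz \o u) (Posz \o v) beta gamma rho sigma ->
  (forall t, t \in T -> (u t < M)%N) -> (forall t, t \in T -> (v t < M)%N) ->
  (M0 <= M)%N -> (0 < L <= M)%N -> (M <= Y ^ h)%N -> (Y <= M)%N -> (M <= Z ^ k)%N ->
  (h.+3`! * (Y ^ h * (M ^ 3 * L ^ 'C(h.+1, 2))) < p)%N ->
  (L * #|T| <= C * Z ^ 2 * (M + L * Y))%N.
Proof.
move=> oh k0; have h0 : (0 < h)%N by rewrite odd_gt0.
(* Since M <= X^h, this J gives X^J >= M^(e + 2), which exceeds the bound for twice the coefficient
   [D]. *)
pose e := 'C(h.+1, 2); pose J := (h * e.+2)%N.
(* The first summand is the threshold of [poly_lt_exp2] for 4 * Z^(2k + 4) < 2^Z; the second gives J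
   + h <= X. *)
pose Z0 := (4 * (2 * k + 4).+1 ^ (2 * k + 4).+1 + (J + h))%N.
exists (2 * h + (h + 4 * h * (2 * h + h * k.+1)))%N.
exists (Z0 ^ k + ((h * k.+1) ^ 2 + 2 * h.+2`!)).+1 => p T u v beta gamma rho sigma M L Y Z pp
  cusp Tu Tv M0M /andP[L0 LM] MY YM MZ p_big.
have M0 : (0 < M)%N by apply: leq_ltn_trans M0M.
have ZZ0 : (Z0 <= Z)%N.
  rewrite -(leq_exp2r _ _ k0); apply: leq_trans MZ; apply: ltnW.
  by apply: leq_ltn_trans M0M; rewrite leq_addr.
have Z_pos : (0 < Z)%N.
  by apply: leq_trans ZZ0; rewrite addn_gt0 muln_gt0 expn_gt0.
have Y0 : (0 < Y)%N.
  by rewrite lt0n; apply/eqP => Y0; move: MY; rewrite Y0 exp0n // leqNgt M0.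
(* The primes are sought above X and up to 2N. As 2^N = (2^Z)^X, the further factor Z in N reduces
   their existence to (2N)^2 < 2^Z. *)
pose X := (Y * Z)%N; pose N := (Y * Z ^ 2)%N.
have X0 : (0 < X)%N by rewrite muln_gt0 Y0.
have N0 : (0 < N)%N by rewrite muln_gt0 Y0 expn_gt0 Z_pos.
have XM : (M <= X ^ h)%N by rewrite (leq_trans MY) // leq_exp2r // leq_pmulr.
have XJ : (2 * (h.+2`! * M ^ e.+1) < X ^ J)%N.
  rewrite [X in (_ < X)%N]expnM; apply: (@leq_trans (M ^ e.+2)); last by rewrite leq_exp2r.
  rewrite mulnA [X in (_ < X)%N]expnS ltn_pmul2r ?expn_gt0 ?M0 //.
  by apply: leq_trans M0M; lia.
have XN : ((2 * N) ^ (X + (J + h)) < 2 ^ N)%N.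
  apply: (@leq_ltn_trans ((2 * N) ^ (2 * X))).
    apply: leq_pexp2l; first by rewrite muln_gt0.
    rewrite mul2n -addnn leq_add2l.
    apply: (@leq_trans Z); last by rewrite leq_pmull.
    by apply: leq_trans ZZ0; rewrite leq_addl.
  have -> : (2 ^ N = (2 ^ Z) ^ X)%N by rewrite -expnM /N /X; congr expn; lia.
  rewrite expnM ltn_exp2r //; apply: (@leq_ltn_trans (4 * Z ^ (2 * k + 4))); last first.
    apply: poly_lt_exp2; apply: leq_trans ZZ0; exact: leq_addr.
  have NZ : (N <= Z ^ (k + 2))%N by rewrite /N expnD leq_mul // (leq_trans YM).
  have -> : (2 * k + 4 = (k + 2) * 2)%N by lia.
  by rewrite expnMn (expnM Z) leq_mul // leq_exp2r.
have X_big : ((h * k.+1)`! * M ^ (\sum_(l < h * k.+1) (l %% h + l %/ h)) <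
    X ^ 'C(h * k.+1, 2))%N.
  by apply: bombieri_pila_exponent => //; apply: leq_trans M0M; lia.
have block a := block_count a pp oh cusp Tu Tv (introT andP (conj L0 LM)) Y0 X0 N0
  p_big XJ XN XM X_big.
set b := (_ + _)%N in block.
have bE : (b <= (2 * h + (h + 4 * h * (2 * h + h * k.+1))) * (Y * Z ^ 2))%N.
  have YN : (Y <= N)%N by rewrite leq_pmulr // expn_gt0 Z_pos.
  rewrite /b -/N; move: (2 * h + h * k.+1)%N => x; rewrite mulnDl [((h + _) * _)%N]mulnDl.
  apply: leq_add; first by rewrite mulnC leq_mul.
  by apply: leq_add; [exact: leq_pmulr | apply: eq_leq; lia].
have T_le : (#|T| <= (M %/ L %/ Y).+1 * b)%N.
  rewrite -[X in (X * _)%N]card_ord -cardsT.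
  apply: (leq_card_fibers (f := fun t => inord (u t %/ L %/ Y))) => // a _.
  apply: leq_trans (block a); apply: subset_leq_card; apply/fintype.subsetP => t.
  rewrite !inE => /andP[tT /eqP <-]; rewrite tT /= inordK //.
  by rewrite ltnS !leq_div2r // ltnW // Tu.
have LY : (L * (M %/ L %/ Y).+1 * Y <= M + L * Y)%N.
  have := leq_trunc_div (M %/ L) Y; have := leq_trunc_div M L.
  move: (M %/ L)%N (M %/ L %/ Y)%N => x y xM yx.
  rewrite mulnAC mulnSr leq_add2r; apply: leq_trans xM.
  by rewrite -mulnA mulnC leq_mul2r mulnC yx orbT.
apply: leq_trans (leq_mul (leqnn L) T_le) _; rewrite mulnA.
apply: leq_trans (leq_mul (leqnn _) bE) _.
set C := (_ + _)%N.
have -> : (L * (M %/ L %/ Y).+1 * (C * (Y * Z ^ 2)) = C * Z ^ 2 * (L * (M %/ L %/ Y).+1 * Y))%N.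
  by lia.
by rewrite leq_mul2l LY orbT.
Qed.

(** * Reduction of the isomorphism count to the cuspidal curve *)

(** Trivial bound: each value of u leaves at most two square roots t. *)
Lemma cusp_card_le (p : nat) (T : {set 'F_p}) (u v : 'F_p -> nat)
    (beta gamma rho sigma : 'F_p) (h M : nat) :
  cusp_param h T (Posz \o u) (Posz \o v) beta gamma rho sigma -> (0 < M)%N ->
  (forall t, t \in T -> (u t < M)%N) -> (#|T| <= 2 * M)%N.
Proof.
move=> [b0 _ Tx _] M0 Tu; have M1 : (M.-1.+1 = M)%N by rewrite prednK.
rewrite mulnC -[X in (X * _)%N]M1 -[X in (X * _)%N]card_ord -cardsT.
apply: (leq_card_fibers (f := fun t => inord (u t))) => // a _.
have := size_quad_power (rho + a%:R) 1 b0; rewrite expr1 muln1 => sz.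
apply: (@leq_card_roots _ _ 2) (eq_leq sz) _; first by rewrite -size_poly_eq0 sz.
move=> t; rewrite inE => /andP[tT /eqP <-]; rewrite inordK ?M1 ?Tu //.
apply/rootP; rewrite !(hornerD, hornerN, hornerZ, hornerXn, hornerC).
by rewrite Tx //= -pmulrn subrr.
Qed.

Lemma fset_set_image_card (T : finType) (X : choiceType) (A : set X) (S : {set T})
    (f : T -> X) :
  (forall x, A x -> exists2 t, t \in S & x = f t) ->
  (#|` fset_set A| <= #|S|)%N.
Proof.
move=> Af; pose B := [fset f t | t in S]%fset.
have AB : (A `<=` [set` B])%classic.
  by move=> x /Af[t tS ->]; apply/imfsetP; exists t.
have finA : finite_set A by apply: sub_finite_set AB _; exact: finite_fset.
apply: (@leq_trans #|` B|).
  apply: fsubset_leq_card; apply/fsubsetP => x; rewrite in_fset_set // inE.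
  exact: AB.
by apply: leq_trans (leq_imfset_card _ _ _) _; rewrite cardE.
Qed.

Lemma Fp_lift (p : nat) (a : int) (x : 'F_p) : prime p ->
  0 <= a < p%:Z -> a%:~R = x -> a = (val x)%:Z.
Proof.
move=> pp; case: a => // n; rewrite /= ltz_nat => np <-.
by rewrite -pmulrn /= val_Fp_nat // modn_small.
Qed.

(** Only t = alpha^2 enters the isomorphism, since the exponents are even. It determines a modulo p,
    hence a itself, as the box lies between 0 and p. *)
Lemma iso_count_cusp (g p h M : nat) (b : 'rV['F_p]_(2 * g)) (r : 'rV[int]_(2 * g)) :
  prime p -> (0 < M)%N ->
  (forall j : 'I_(2 * g), 0 <= r 0 j < r 0 j + M%:Z /\ r 0 j + M%:Z < p%:Z) ->
  (3 <= h <= 2 * g + 1)%N ->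
  iso_count b (int_box r M) = 0%N \/
  exists T : {set 'F_p}, exists u v : 'F_p -> nat, exists beta gamma rho sigma : 'F_p,
    [/\ cusp_param h T (Posz \o u) (Posz \o v) beta gamma rho sigma,
        forall t, t \in T -> (u t < M)%N, forall t, t \in T -> (v t < M)%N &
        (iso_count b (int_box r M) <= #|T|)%N].
Proof.
move=> pp M0 r_box /andP[h3 hg]; pose A : set 'rV[int]_(2 * g) :=
  [set a | int_box r M a /\ curve_iso (map_mx intr a) b]%classic.
have pF := dvdz_pcharf (pchar_Fp pp).
have ix_lt : (2 * g - 1 < 2 * g)%N by lia.
have iy_lt : (2 * g + 1 - h < 2 * g)%N by lia.
(* At these two indices the exponent 2g + 1 - i of t equals 2 and h. *)
pose ix := Ordinal ix_lt; pose iy := Ordinal iy_lt.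
have A_entry a : A a -> forall i : 'I_(2 * g),
    [/\ 0 <= a 0 i < p%:Z, r 0 i + 1 <= a 0 i <= r 0 i + M%:Z & (a 0 i)%:~R != 0 :> 'F_p].
  move=> [a_box _] i; have [/= r1 r2] := r_box i; have ai := a_box i.
  have a1 : 0 < a 0 i by lia.
  have a2 : 0 <= a 0 i < p%:Z by lia.
  split=> //; rewrite -pF; apply/negP; rewrite dvdzE /= => /dvdn_leq.
  by rewrite absz_gt0 gt_eqF // => /(_ isT); lia.
have A0 i : b 0 i = 0 -> A = set0.
  move=> bi; apply/seteqP; split=> // a Aa; have [_ _ /eqP[]] := A_entry a Aa i.
  have [_ [alpha _ /(_ i)]] := Aa; rewrite mxE bi mulr0; exact.
have [bx|bx] := eqVneq (b 0 ix) 0; first by left; rewrite /iso_count -/A (A0 _ bx) fset_set0 cardfs0.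
have [by0|by0] := eqVneq (b 0 iy) 0; first by left; rewrite /iso_count -/A (A0 _ by0) fset_set0 cardfs0.
right.
pose inbox (i : 'I_(2 * g)) (x : 'F_p) := r 0 i + 1 <= (val x)%:Z <= r 0 i + M%:Z.
pose T := [set t : 'F_p | inbox ix (b 0 ix * t ^+ 2) && inbox iy (b 0 iy * t ^+ h)]%SET.
pose w (i : 'I_(2 * g)) (x : 'F_p) : nat := `|((val x)%:Z - (r 0 i + 1))%R|%N.
have wE i x : inbox i x -> (w i x)%:Z = (val x)%:Z - (r 0 i + 1).
  by rewrite /inbox /w; lia.
have wx i x : inbox i x -> x = (r 0 i + 1)%:~R + (w i x)%:Z%:~R.
  by move=> /wE ->; rewrite -rmorphD /= addrC subrK -pmulrn natr_Zp.
have wM i x : inbox i x -> (w i x < M)%N by move=> ix'; have := wE i x ix'; move: ix'; rewrite /inbox; lia.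
exists T, (fun t => w ix (b 0 ix * t ^+ 2)), (fun t => w iy (b 0 iy * t ^+ h)).
exists (b 0 ix), (b 0 iy), (r 0 ix + 1)%:~R, (r 0 iy + 1)%:~R; split.
- by split=> // t; rewrite inE => /andP[ix' iy']; exact: wx.
- by move=> t; rewrite inE => /andP[ix' _]; exact: wM.
- by move=> t; rewrite inE => /andP[_ iy']; exact: wM.
pose f (t : 'F_p) : 'rV[int]_(2 * g) := \row_i (val (t ^+ (2 * g + 1 - i) * b 0 i))%:Z.
apply: (@fset_set_image_card _ _ _ _ f) => a Aa.
have [_ [alpha _ a_iso]] := Aa.
have aE i : a 0 i = (val ((alpha ^+ 2) ^+ (2 * g + 1 - i) * b 0 i))%:Z.
  have [a1 _ _] := A_entry a Aa i; apply: Fp_lift => //.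
  have := a_iso i; rewrite mxE => ->; rewrite -exprM; congr (_ ^+ _ * _).
  by have := ltn_ord i; lia.
exists (alpha ^+ 2); last by apply/rowP => i; rewrite mxE aE.
rewrite inE; apply/andP; split; rewrite /inbox mulrC.
  have [_ + _] := A_entry a Aa ix; rewrite aE /=.
  by rewrite (_ : (2 * g + 1 - (2 * g - 1) = 2)%N) //; lia.
have [_ + _] := A_entry a Aa iy; rewrite aE /=.
by rewrite (_ : (2 * g + 1 - (2 * g + 1 - h) = h)%N) //; lia.
Qed.

(** * The bound in real form *)

(** The least Y with M <= Y^h is below M^(1/h) + 1, and M^(1/h) >= 1. *)
Lemma nat_root_ceil (R : realType) (h M : nat) : (0 < h)%N -> (0 < M)%N ->
  exists Y : nat, [/\ (M <= Y ^ h)%N, (Y <= M)%N & Y%:R <= 2 * M%:R `^ (1 / h%:R) :> R].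
Proof.
move=> h0 M0; have exY : exists Y, (M <= Y ^ h)%N.
  by exists M; rewrite -[leqLHS]expn1 leq_pexp2l.
case: (ex_minnP exY) => Y MY Ymin; exists Y; split=> //.
  by apply: Ymin; rewrite -[leqLHS]expn1 leq_pexp2l.
set y := _ `^ _; have m1 : 1 <= M%:R :> R by rewrite ler1n.
have hr : h%:R != 0 :> R by rewrite pnatr_eq0 -lt0n.
have yh : y ^+ h = M%:R.
  by rewrite -powR_mulrn ?powR_ge0 // -powRrM mul1r mulVf // powRr1.
have y1 : 1 <= y.
  by rewrite -(powRr0 M%:R) ler_powR // divr_ge0.
case: Y MY Ymin => [|Y] MY Ymin; first by rewrite mulr_ge0 // powR_ge0.
have Yy : Y%:R < y.
  rewrite ltNge; apply/negP => yY.
  have : (M <= Y ^ h)%N.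
    by rewrite -(ler_nat R) natrX -yh lerXn2r ?nnegrE ?powR_ge0.
  by move=> /Ymin; rewrite ltnn.
by rewrite -natr1; lra.
Qed.

Lemma cusp_count_real (R : realType) (h : nat) (delta : R) : odd h -> 0 < delta ->
  exists M1 : nat, forall (p : nat) (T : {set 'F_p}) (u v : 'F_p -> nat)
    (beta gamma rho sigma : 'F_p) (M : nat),
  prime p -> cusp_param h T (Posz \o u) (Posz \o v) beta gamma rho sigma ->
  (forall t, t \in T -> (u t < M)%N) -> (forall t, t \in T -> (v t < M)%N) ->
  (M1 <= M)%N ->
  #|T|%:R < (M%:R `^ (1 / h%:R)
     + M%:R * (M%:R ^+ 4 / p%:R) `^ (2 / (h%:R * (h%:R + 1)))) * M%:R `^ delta.
Proof.
move=> oh d0; have h0 : (0 < h)%N by rewrite odd_gt0.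
(* This k makes Z^2 at most 4 * M^(delta / 2); the other half of delta will absorb the constants. *)
pose k := (Num.truncn (4 / delta)).+1.
have kd : 2 * (1 / k%:R) <= delta / 2.
  have := truncn_itv (divr_ge0 (ler0n R 4) (ltW d0)) => /andP[_]; rewrite -/k => lt.
  have k_gt0 : 0 < k%:R :> R by rewrite ltr0n.
  rewrite mul1r ler_pdivlMr // mulrAC ler_pdivrMr //.
  by move: lt; rewrite ltr_pdivrMr // mulrC; lra.
have [C [M0 H]] := cusp_count oh (isT : 0 < k)%N.
pose e := 'C(h.+1, 2).
(* The factor 2^h comes from Y <= 2 * M^(1/h), and the last 2 makes the inequality with p strict.
   The existential keeps c opaque. *)
have [c cE] : exists c, c = (h.+3`! * 2 ^ h * 2)%N by exists (h.+3`! * 2 ^ h * 2)%N.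
pose C' : R := 2 * c%:R + 4 * C%:R * (2 * c%:R + 3) + 1.
have C'_gt0 : 0 < C' by rewrite /C' ltr_wpDl // addr_ge0 ?mulr_ge0 ?addr_ge0 ?mulr_ge0.
exists (maxn M0 (Num.truncn (C' `^ (2 / delta))).+1).
move=> p T u v beta gamma rho sigma M pp cusp Tu Tv; rewrite geq_max => /andP[M0M M1M].
have M_gt0 : (0 < M)%N by apply: leq_trans M1M.
set m : R := M%:R; set y := m `^ (1 / _); set s := 2 / (_ * _); set X := _ / p%:R.
have m1 : 1 <= m by rewrite ler1n.
have m0 : 0 < m by rewrite ltr0n.
have p0 : 0 < p%:R :> R by rewrite ltr0n prime_gt0.
have h0r : 0 < h%:R :> R by rewrite ltr0n.
have X0 : 0 < X by rewrite divr_gt0 // exprn_gt0.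
have c0 : 0 < c%:R :> R by rewrite ltr0n cE !muln_gt0 fact_gt0 expn_gt0.
have c1 : 1 <= c%:R :> R by rewrite ler1n cE !muln_gt0 fact_gt0 expn_gt0.
have C_big : C' < m `^ (delta / 2).
  have -> : C' = (C' `^ (2 / delta)) `^ (delta / 2).
    rewrite -powRrM (_ : 2 / delta * (delta / 2) = 1) ?powRr1 ?ltW //.
    by field; rewrite gt_eqF.
  apply: gt0_ltr_powR; rewrite ?divr_gt0 ?nnegrE ?powR_ge0 ?ltW //.
  have := truncn_itv (powR_ge0 C' (2 / delta)) => /andP[_ lt].
  by apply: lt_le_trans lt _; rewrite ler_nat.
have s0 : 0 < s by rewrite divr_gt0 // mulr_gt0 // ltr_wpDl.
have s1 : s <= 1.
  rewrite ler_pdivrMr ?mul1r ?mulr_gt0 ?ltr_wpDl //.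
  have : 1 <= h%:R :> R by rewrite ler1n.
  by move: (h%:R : R) => z; nra.
have se : s * e%:R = 1.
  have : 2 * e%:R = (h%:R + 1) * h%:R :> R by rewrite -natrM mul2_bin2 natrM natr1.
  by move=> e2; rewrite /s mulrAC e2 [(_ + 1) * _]mulrC divff // mulf_neq0 // gt_eqF // ltr_wpDl.
set G := m * X `^ s; have G0 : 0 < G by rewrite mulr_gt0 // powR_gt0.
have y0 : 0 < y by rewrite powR_gt0.
have y1 : 1 <= y by rewrite -[leLHS](powRr0 m) ler_powR // divr_ge0.
have [Y [MY YM Yy]] := nat_root_ceil R h0 M_gt0.
have [Z [MZ ZM Zz]] := nat_root_ceil R (isT : 0 < k)%N M_gt0.
have yh : y ^+ h = m.
  by rewrite -powR_mulrn ?powR_ge0 // -powRrM mul1r mulVf ?powRr1 ?ltW // gt_eqF.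
have Yh : (Y ^ h <= 2 ^ h * M)%N.
  by rewrite -(ler_nat R) natrX natrM natrX -/m -yh -exprMn lerXn2r ?nnegrE ?mulr_ge0 ?powR_ge0.
have Z2 : Z%:R ^+ 2 <= 4 * m `^ (delta / 2).
  apply: le_trans (_ : (2 * m `^ (1 / k%:R)) ^+ 2 <= _).
    by rewrite lerXn2r ?nnegrE ?mulr_ge0 ?powR_ge0.
  rewrite exprMn -natrX ler_wpM2l // -powR_mulrn ?powR_ge0 // -powRrM mulrC.
  exact: ler_powR.
(* As s = 1 / e, this solves c * X * x^e = 1, the limit for an admissible L. By [mx], M / x is at
   most c * G. *)
pose x := (c%:R * X)^-1 `^ s.
have cX0 : 0 < c%:R * X by rewrite mulr_gt0.
have x0 : 0 < x by rewrite powR_gt0 // invr_gt0.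
have mx : m <= x * c%:R * G.
  have e1 : x * (c%:R * X) `^ s = 1.
    by rewrite -powRM ?invr_ge0 ?ltW // mulVf ?powR1 // gt_eqF.
  rewrite powRM ?ltW // in e1.
  have cs : c%:R `^ s <= c%:R :> R by apply: ler1_powR.
  have -> : x * c%:R * G = m * (x * (c%:R * X `^ s)) by rewrite /G; ring.
  apply: ler_peMr; first exact: ltW.
  rewrite -[leLHS]e1; apply: ler_wpM2l; first exact: ltW.
  by apply: ler_wpM2r; rewrite ?powR_ge0.
pose L0 := Num.truncn x.
have /andP[L0x xL0] := truncn_itv (ltW x0).
have main : #|T|%:R <= (2 * c%:R + 4 * C%:R * (2 * c%:R + 3)) * (m `^ (delta / 2)) * (y + G).
  have md1 : 1 <= m `^ (delta / 2) by rewrite -[leLHS](powRr0 m) ler_powR // divr_ge0 // ltW.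
  set D := m `^ _ in md1 Z2 *.
  have [D0 c0' G0' y0'] : [/\ 0 <= D, 0 <= c%:R :> R, 0 <= G & 0 <= y].
    by split; [exact: le_trans ler01 md1 | | exact: ltW | exact: ltW].
  have C0 : 0 <= 4 * C%:R * (2 * c%:R + 3) :> R by rewrite !mulr_ge0 // addr_ge0 ?mulr_ge0.
  (* If x < 1, there is no positive integer L up to x, but then M <= c * G and the trivial bound 2M
     suffices. *)
  have [L00|L0_gt0] := posnP L0.
    have := cusp_card_le cusp M_gt0 Tu; rewrite -(ler_nat R) natrM -/m => N2.
    have x1 : x <= 1 by move: xL0; rewrite -/L0 L00 => /ltW.
    have mcG : m <= c%:R * G.
      by apply: le_trans mx _; rewrite -mulrA ler_piMl // mulr_ge0 // ltW.
    apply: le_trans N2 _; apply: le_trans (_ : 2 * c%:R * G <= _).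
      by rewrite -mulrA ler_wpM2l.
    apply: ler_pM; rewrite ?mulr_ge0 ?powR_ge0 ?lerDr //.
    by rewrite -[leLHS]mulr1; apply: ler_pM; rewrite ?mulr_ge0 ?lerDl.
  pose L := minn L0 M.
  have L_bounds : (0 < L <= M)%N by rewrite leq_min L0_gt0 M_gt0 geq_minr.
  have Lr : 0 < L%:R :> R by rewrite ltr0n; case/andP: L_bounds.
  have p_big : (h.+3`! * (Y ^ h * (M ^ 3 * L ^ e)) < p)%N.
    have : (c * (M ^ 4 * L ^ e) <= p)%N.
      rewrite -(ler_nat R) natrM [(M ^ 4 * _)%:R]natrM !natrX -/m.
      have : L%:R ^+ e <= (c%:R * X)^-1.
        apply: le_trans (_ : x ^+ e <= _); last first.
          by rewrite -powR_mulrn ?(ltW x0) // -powRrM se powRr1 // invr_ge0 ltW.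
        rewrite lerXn2r ?nnegrE ?(ltW x0) //; apply: le_trans L0x.
        by rewrite ler_nat geq_minl.
      rewrite -(ler_pM2l cX0) divff ?gt_eqF // /X => le1.
      rewrite -[leRHS]mul1r -ler_pdivrMr //; apply: le_trans le1.
      have -> : c%:R * (m ^+ 4 * L%:R ^+ e) / p%:R = c%:R * (m ^+ 4 / p%:R) * L%:R ^+ e.
        by rewrite !mulrA [LHS]mulrAC.
      by [].
    set a := (h.+3`! * ((2 ^ h * M) * (M ^ 3 * L ^ e)))%N => ca.
    apply: (@leq_ltn_trans a); first by rewrite leq_mul // leq_mul.
    have a0 : (0 < a)%N.
      by rewrite !muln_gt0 fact_gt0 !expn_gt0 M_gt0; case/andP: L_bounds => ->.
    have a2 : (2 * a = c * (M ^ 4 * L ^ e))%N.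
      rewrite /a cE (expnS M 3).
      by move: (h.+3)`! (2 ^ h)%N (M ^ 3)%N (L ^ e)%N => x1 x2 x3 x4; ring.
    by apply: leq_trans ca; rewrite -a2 mul2n -addnn -[ltnLHS]addn0 ltn_add2l.
  (* For L = L0 use x <= 2 * L0 and [mx]; for L = M the summand 1 suffices. *)
  have mL : m <= L%:R * (2 * c%:R * G + 1).
    rewrite /L /minn; case: ifP => _.
      apply: le_trans mx _; rewrite mulrDr mulr1.
      have L1 : 1 <= L0%:R :> R by rewrite ler1n.
      have : x <= 2 * L0%:R by move: xL0; rewrite -/L0 -natr1; lra.
      move=> x2; apply: le_trans (_ : (2 * L0%:R) * c%:R * G <= _).
        by rewrite !ler_wpM2r.
      have -> : 2 * L0%:R * c%:R * G = L0%:R * (2 * c%:R * G) by ring.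
      by rewrite lerDl.
    by rewrite ler_peMr ?(ltW m0) // lerDr mulr_ge0 // mulr_ge0.
  have := H p T u v beta gamma rho sigma M L Y Z pp cusp Tu Tv M0M L_bounds MY YM MZ p_big.
  rewrite -(ler_nat R) !(natrM, natrD, natrX) -/m => HN.
  have N_le : #|T|%:R <= C%:R * Z%:R ^+ 2 * (2 * c%:R * G + 1 + Y%:R).
    rewrite -(ler_pM2l Lr); apply: le_trans HN _.
    by rewrite [leRHS]mulrCA ler_wpM2l ?mulr_ge0 ?exprn_ge0 // mulrDr lerD2r.
  apply: le_trans N_le _.
  apply: le_trans (_ : C%:R * (4 * D) * ((2 * c%:R + 3) * (y + G)) <= _).
    apply: ler_pM; rewrite ?mulr_ge0 ?exprn_ge0 ?addr_ge0 ?mulr_ge0 ?powR_ge0 //.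
      by rewrite ler_wpM2l.
    have : 0 <= c%:R * y by rewrite mulr_ge0.
    by move: Yy; rewrite -/m -/y => Yy cy; lra.
  have -> : C%:R * (4 * D) * ((2 * c%:R + 3) * (y + G)) = 4 * C%:R * (2 * c%:R + 3) * D * (y + G).
    by ring.
  apply: ler_wpM2r; first exact: addr_ge0.
  by apply: ler_wpM2r => //; rewrite lerDr mulr_ge0.
have d2 : m `^ delta = m `^ (delta / 2) * m `^ (delta / 2).
  by rewrite -powRD ?gt_eqF ?implybT // -splitr.
apply: le_lt_trans main _; rewrite d2 [ltRHS]mulrC ltr_pM2r ?addr_gt0 //.
rewrite ltr_pM2r ?powR_gt0 //; apply: lt_trans C_big.
by rewrite /C' ltrDl.
Qed.

(** * The exponent o(1) *)

Local Open Scope classical_set_scope.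
Local Open Scope ring_scope.

(** Quantifying over p, b and the box inside the predicate makes the exponent uniform in them. *)
Definition iso_count_bound (R : realType) (g h M : nat) (e : R) : Prop :=
  forall (p : nat) (b : 'rV['F_p]_(2 * g)) (r : 'rV[int]_(2 * g)),
    prime p -> (0 < M)%N ->
    (forall j : 'I_(2 * g), 0 <= r 0 j < r 0 j + M%:Z /\ r 0 j + M%:Z < p%:Z) ->
    (iso_count b (int_box r M))%:R <
      (M%:R `^ (1 / h%:R) + M%:R * (M%:R ^+ 4 / p%:R) `^ (2 / (h%:R * (h%:R + 1))))
      * M%:R `^ e :> R.

Lemma near_iso_count_bound (R : realType) (g : nat) (delta : R) : 0 < delta ->
  \forall M \near \oo, forall h : nat, odd h -> (3 <= h <= 2 * g + 1)%N ->
    iso_count_bound g h M delta.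
Proof.
move=> d0.
(* Only finitely many h occur, so the thresholds for the separate h can be combined. *)
suff W : \forall M \near \oo, forall h : 'I_(2 * g).+2, odd h -> (3 <= h <= 2 * g + 1)%N ->
    iso_count_bound g h M delta.
  apply: filterS W => M HM h oh hg; have h_lt : (h < (2 * g).+2)%N by lia.
  exact: (HM (Ordinal h_lt)).
apply: filter_forall => h.
have [oh|_] := boolP (odd h); last by apply: nearW.
have [M1 HM1] := cusp_count_real oh d0.
near=> M => _ hg p b r pp M0 r_box.
have M1M : (M1 <= M)%N by near: M; exact: nbhs_infty_ge.
have [->|[T [u [v [beta [gamma [rho [sigma [cusp Tu Tv N_le]]]]]]]]] :=
  iso_count_cusp b pp M0 r_box hg.
  have m0 : 0 < M%:R :> R by rewrite ltr0n.
  have p0 : 0 < p%:R :> R by rewrite ltr0n prime_gt0.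
  by rewrite mulr_gt0 ?powR_gt0 // addr_gt0 ?mulr_gt0 ?powR_gt0 // divr_gt0 ?exprn_gt0.
apply: le_lt_trans (HM1 p T u v beta gamma rho sigma M pp cusp Tu Tv M1M).
by rewrite ler_nat.
Unshelve. all: by end_near.
Qed.

(** A crude exponent valid for every M: the count is at most 2M <= M^2 for M >= 2, and at most 1 for
    M = 1. It makes the infimum below one of a nonempty set. *)
Lemma iso_count_bound2 (R : realType) (g h M : nat) : (3 <= h <= 2 * g + 1)%N ->
  iso_count_bound g h M (2 : R).
Proof.
move=> hg p b r pp M0 r_box; set G := _ * _ `^ (2 / _).
have m1 : 1 <= M%:R :> R by rewrite ler1n.
have m0 : 0 < M%:R :> R by rewrite ltr0n.
have G0 : 0 < G.
  by rewrite mulr_gt0 ?powR_gt0 // divr_gt0 ?exprn_gt0 // ltr0n prime_gt0.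
have y1 : 1 <= M%:R `^ (1 / h%:R) :> R by rewrite -[leLHS](powRr0 M%:R) ler_powR // divr_ge0.
rewrite powR_mulrn ?ltW //.
apply: (@le_lt_trans _ _ (M%:R ^+ 2)); last first.
  by rewrite ltr_pMl ?exprn_gt0 // (le_lt_trans y1) // ltrDl.
rewrite -natrX ler_nat.
have [M1|M_ne1] := eqVneq M 1%N.
  rewrite M1 -[leqRHS](cards1 tt); apply: (fset_set_image_card (f := fun=> \row_j (r 0 j + 1))).
  move=> a [a_box _]; exists tt; first by rewrite inE.
  apply/rowP => j; rewrite mxE; have /andP[a1 a2] := a_box j.
  by apply/eqP; rewrite eq_le; apply/andP; split; [exact: a2 | exact: a1].
have [->|[T [u [v [beta [gamma [rho [sigma [cusp Tu Tv N_le]]]]]]]]] :=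
  iso_count_cusp b pp M0 r_box hg; first by [].
apply: leq_trans N_le _; apply: leq_trans (cusp_card_le cusp M0 Tu) _.
by rewrite -mulnn leq_mul2r; apply/orP; right; lia.
Qed.

Theorem theorem7 (R : realType) (g : nat) (hg : (1 <= g)%N) :
  exists eps : nat -> R,
    (eps @ \oo --> (0 : R)) /\
    forall (p : nat) (b : 'rV['F_p]_(2 * g)) (M : nat) (r : 'rV[int]_(2 * g))
      (h : nat),
      prime p ->
      coprime p (2 * (2 * g + 1)) ->
      nonsingular b ->
      (1 <= M < p)%N ->
      (forall j : 'I_(2 * g),
         0 <= r 0 j < r 0 j + M%:Z /\ r 0 j + M%:Z < p%:Z) ->
      odd h ->
      (3 <= h <= 2 * g + 1)%N ->
      ((iso_count b (int_box r M))%:R : R) <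
        (M%:R `^ (1 / h%:R)
         + M%:R * (M%:R ^+ 4 / p%:R) `^ (2 / (h%:R * (h%:R + 1))))
        * M%:R `^ (eps M).
Proof.
(* The exponents valid for all h at once; requiring 0 <= e bounds the set below. *)
pose E (M : nat) : set R := [set e | 0 <= e /\
  forall h, odd h -> (3 <= h <= 2 * g + 1)%N -> iso_count_bound g h M e].
have E_lb M : has_lbound (E M) by exists 0 => e [].
have E_inf M : has_inf (E M).
  by split=> //; exists 2; split=> // h _; exact: iso_count_bound2.
have inf_ge0 M : 0 <= inf (E M).
  by apply: lb_le_inf; [case: (E_inf M) | move=> e []].
(* The infimum need not be attained, whence the term 1 / (M + 1). *)
exists (fun M => inf (E M) + M.+1%:R^-1); split.
  apply/cvgrPdist_le => e e0; have e20 : 0 < e / 2 by rewrite divr_gt0.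
  near=> M; rewrite sub0r normrN ger0_norm ?addr_ge0 ?invr_ge0 //.
  rewrite [leRHS]splitr; apply: lerD.
    apply: ge_inf => //; split; first exact: ltW.
    near: M; exact: near_iso_count_bound.
  by apply: ltW; near: M; exact: near_infty_natSinv_lt (PosNum e20).
move=> p b M r h pp _ _ /andP[M0 _] r_box oh hle.
have M_pos : 0 < M.+1%:R^-1 :> R by rewrite invr_gt0.
(* An admissible exponent below the chosen one; as M >= 1, raising the exponent only weakens the
   bound. *)
have [e [_ e_bound] e_lt] := inf_adherent M_pos (E_inf M).
apply: lt_le_trans (e_bound h oh hle p b r pp M0 r_box) _.
rewrite ler_wpM2l ?addr_ge0 ?mulr_ge0 ?powR_ge0 //.
by apply: ler_powR; [rewrite ler1n | exact: ltW].
Unshelve. all: by end_near.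
Qed.
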